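(* There is a cardinal \(\kappa\) which is not CRITTM-clockable such that the ordinal \(\kappa+\omega\) is CRITTM-clockable.
   Context: An infinite time Turing machine (ITTM) has three tapes, each with cells indexed by \(\omega\) holding 0 or 1, a head, and a finite program with finitely many states including a start, a halt and a special \emph{limit} state. At successor stages it acts as an ordinary Turing machine; at limit ordinal stages the head is placed on the first cell, the state is the limit state, and each cell's value is the \(\limsup\) of its previous values. A cardinal-recognizing ITTM (CRITTM) has the same hardware and behaviour, except that it has an additional special \emph{cardinal} state: at every uncountable cardinal stage, the head is on the first cell, the machine is in the cardinal state, and cell values are the \(\limsup\) of previous values; at other limit stages it behaves like an ITTM. An ordinal \(\delta\) is CRITTM-clockable if some CRITTM program, run on empty (all-zero) input, halts at exactly stage \(\delta\). *)

(* Defs.v *)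
From Stdlib Require Import Relations Wellfounded.
From mathcomp Require Import all_boot.
From mathcomp Require Import boolp classical_sets functions cardinality.
Set Implicit Arguments.
Unset Strict Implicit.
Unset Printing Implicit Defensive.

Local Open Scope classical_set_scope.
Local Open Scope card_scope.

(** * Ordinals *)

(* An ordinal is presented by a well-ordered type of that order type; all the
   notions below are invariant under order isomorphism. *)
Record ordinal_number := OrdinalNumber {
  ord_sort :> Type;
  olt : ord_sort -> ord_sort -> Prop;
  olt_wf : well_founded olt;
  olt_trans : forall x y z, olt x y -> olt y z -> olt x z;
  olt_total : forall x y, olt x y \/ x = y \/ olt y x
}.

Definition ole (A : ordinal_number) (x y : A) : Prop := x = y \/ olt x y.

Section Segment.
Variables (A : ordinal_number) (x : A).

Definition seg_lt (u v : {y : A | olt y x}) : Prop := olt (sval u) (sval v).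

Lemma seg_wf : well_founded seg_lt.
Proof. exact: (wf_inverse_image _ _ _ _ (@olt_wf A)). Qed.

Lemma seg_trans u v w : seg_lt u v -> seg_lt v w -> seg_lt u w.
Proof. exact: olt_trans. Qed.

Lemma seg_total u v : seg_lt u v \/ u = v \/ seg_lt v u.
Proof.
case: (olt_total (sval u) (sval v)) => [|[|]]; [by left| |by right; right].
by move=> uv; right; left; apply: eq_sig_hprop uv => *; apply: Prop_irrelevance.
Qed.

(* The ordinal represented by the element x: the order type of its
   predecessors. *)
Definition segment : ordinal_number :=
  OrdinalNumber seg_wf seg_trans seg_total.
End Segment.

Section Sum.
Variables A B : ordinal_number.

Definition add_lt : A + B -> A + B -> Prop := le_AsB A B (@olt A) (@olt B).

Lemma add_wf : well_founded add_lt.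
Proof. exact: (wf_disjoint_sum _ _ _ _ (@olt_wf A) (@olt_wf B)). Qed.

Lemma add_trans u v w : add_lt u v -> add_lt v w -> add_lt u w.
Proof.
case=> [x y xy|x y|x y xy] H; inversion H; subst; constructor;
  by apply: olt_trans xy _.
Qed.

Lemma add_total u v : add_lt u v \/ u = v \/ add_lt v u.
Proof.
case: u v => [x|x] [y|y].
- case: (olt_total x y) => [xy|[->|yx]]; [|by right; left|].
    by left; constructor.
  by right; right; constructor.
- by left; constructor.
- by right; right; constructor.
- case: (olt_total x y) => [xy|[->|yx]]; [|by right; left|].
    by left; constructor.
  by right; right; constructor.
Qed.

Definition ord_add : ordinal_number :=
  OrdinalNumber add_wf add_trans add_total.
End Sum.

Lemma nat_lt_wf : well_founded (fun m n : nat => m < n).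
Proof. by elim/ltn_ind => n IH; constructor. Qed.

Lemma nat_lt_trans (m n p : nat) : m < n -> n < p -> m < p.
Proof. exact: ltn_trans. Qed.

Lemma nat_lt_total (m n : nat) : m < n \/ m = n \/ n < m.
Proof. by case: (ltngtP m n); auto. Qed.

Definition ord_omega : ordinal_number :=
  OrdinalNumber nat_lt_wf nat_lt_trans nat_lt_total.

Lemma unit_lt_wf : well_founded (fun _ _ : unit => False).
Proof. by []. Qed.

Lemma unit_lt_trans (x y z : unit) : False -> False -> False.
Proof. by []. Qed.

Lemma unit_lt_total (x y : unit) : False \/ x = y \/ False.
Proof. by case: x y => [] []; auto. Qed.

Definition ord_one : ordinal_number :=
  OrdinalNumber unit_lt_wf unit_lt_trans unit_lt_total.

(* Cardinals are initial ordinals. *)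
Definition is_cardinal (A : ordinal_number) : Prop :=
  forall x : A, ~ ([set: A] #= [set: segment x]).

Definition is_uncountable_cardinal (A : ordinal_number) : Prop :=
  is_cardinal A /\ ~ countable [set: A].

Section Stages.
Variable A : ordinal_number.
Implicit Types x y z : A.

Definition is_zero x : Prop := forall y, ~ olt y x.

Definition is_succ y x : Prop := olt y x /\ forall z, olt z x -> ole z y.

Definition is_limit x : Prop := ~ is_zero x /\ forall y, ~ is_succ y x.

(* The infimum over y < x of the supremum of f over the stages z with
   y <= z < x, in the two-element order false < true. *)
Definition limsup_at x (f : A -> bool) : bool :=
  `[< forall y, olt y x -> exists z, [/\ ole y z, olt z x & f z] >].
End Stages.

(** * Machines *)

(* The four special states and n further ones. *)
Inductive state (n : nat) : Type :=
| q_start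
| q_halt
| q_limit
| q_cardinal
| q_other of 'I_n.
Arguments q_start {n}.
Arguments q_halt {n}.
Arguments q_limit {n}.
Arguments q_cardinal {n}.

Inductive direction : Type := go_left | go_right.

(* The contents of the cells of the three tapes at one position. *)
Definition symbols : Type := (bool * bool * bool)%type.

Record program := Program {
  nstates : nat;
  trans : state nstates -> symbols -> state nstates * symbols * direction
}.

Record config (n : nat) := Config {
  cstate : state n;
  chead : nat;
  tape1 : nat -> bool;
  tape2 : nat -> bool;
  tape3 : nat -> bool
}.

Definition write_cell (t : nat -> bool) (i : nat) (b : bool) : nat -> bool :=
  fun j => if j == i then b else t j.

(* A left move from the first cell leaves the head there. *)
Definition move_head (d : direction) (i : nat) : nat :=
  match d with go_left => i.-1 | go_right => i.+1 end.

Definition step (p : program) (c : config (nstates p)) : config (nstates p) :=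
  let i := chead c in
  let: (q, (b1, b2, b3), d) :=
    trans (cstate c) (tape1 c i, tape2 c i, tape3 c i) in
  Config q (move_head d i)
    (write_cell (tape1 c) i b1) (write_cell (tape2 c) i b2) (write_cell (tape3 c) i b3).

Definition empty_config (n : nat) : config n :=
  Config q_start 0 (fun _ => false) (fun _ => false) (fun _ => false).

Definition limit_config (n : nat) (A : ordinal_number) (x : A)
    (c : A -> config n) (q : state n) : config n :=
  Config q 0
    (fun i => limsup_at x (fun y => tape1 (c y) i))
    (fun i => limsup_at x (fun y => tape2 (c y) i))
    (fun i => limsup_at x (fun y => tape3 (c y) i)).

(* c is the sequence of configurations of p on empty input, indexed by the
   stages below A.  The sequence is not stopped at the halting state; see
   halts_at. *)
Record is_run (p : program) (A : ordinal_number) (c : A -> config (nstates p)) :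
    Prop := IsRun {
  run_zero : forall x, is_zero x -> c x = empty_config (nstates p);
  run_succ : forall y x, is_succ y x -> c x = step (c y);
  run_cardinal : forall x, is_uncountable_cardinal (segment x) ->
    c x = limit_config x c q_cardinal;
  run_limit : forall x, is_limit x -> ~ is_uncountable_cardinal (segment x) ->
    c x = limit_config x c q_limit
}.

(* Halting at stage d means that the transition performed at stage d enters the
   halting state and that no earlier one does.  (At a limit stage the machine is
   in the limit or the cardinal state, so being in the halting state at stage d
   would rule out every limit d.)  The stages <= d form the ordinal d + 1, with
   last element inr tt. *)
Definition halts_at (p : program) (d : ordinal_number) : Prop :=
  exists c : ord_add d ord_one -> config (nstates p),
    [/\ is_run c,
        cstate (step (c (inr tt))) = q_halt &
        forall x : d, cstate (step (c (inl x))) <> q_halt].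

Definition clockable (d : ordinal_number) : Prop :=
  exists p : program, halts_at p d.

(* Main.v *)
Require Import Defs.
From Stdlib Require Import Relations.
From mathcomp Require Import all_boot zify.
From mathcomp Require Import boolp classical_sets functions cardinality wochoice.

Set Implicit Arguments.
Unset Strict Implicit.
Unset Printing Implicit Defensive.

(* One machine M simulates all machines at once.  Inside each block
   [b, b + omega) of stages, b being zero or a limit, M dovetails the first
   omega steps of every machine after stage b; so M and the simulated machines
   agree on time at all limit stages, the simulated cells take the right limsup
   for free, and M sees an uncountable cardinal exactly when the simulated
   machines do.  At an uncountable cardinal M raises a flag in its first cell and
   lowers it as soon as some machine halts for the first time within the block;
   it halts at a non-cardinal limit at which the flag is still up.  Since there
   are only countably many machines, there is a least uncountable cardinal kappa
   with no machine halting in [kappa, kappa + omega).  It is not clockable, and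
   M halts at kappa + omega.

   A run of M is made of register operations: its volatile memory is a finite
   set of unary counters that are reset at the beginning of each block, because
   limit stages destroy it, and the dovetailing is a primitive recursive
   transition function on the number held by one of these counters. *)

(** The limsup rule shapes the simulation. A cell showing a wrong bit cofinally often would spoil
    the next limit, so a simulated cell may lag behind, but every bit it shows must be one the
    simulated cell really has, and every bit of the simulated cell must be shown eventually. The
    relation [tracks] states this; one instance compares the compiled machine with its numeric
    control, another compares that control with the simulated machine, and the two are composed.
    Each simulated tape gets an extra cell that goes up when its machine halts and stays up through
    limits. Hence every machine has at most one stage of first halting, and a sufficiently large
    cardinal lies beyond all of them. The flag causes no premature halt: a limit of uncountable
    cardinals is itself one, so M is not in its limit state there; below any other limit the
    cardinal stages are bounded, and before kappa every raised flag has been lowered again. Finally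
    kappa + omega has the cardinality of kappa, so it is no cardinal, and M meets the raised flag
    there in its limit state. *)

Definition tape : Type := nat -> symbols.

Definition fput (T : Type) (f : nat -> T) (i : nat) (v : T) : nat -> T :=
  fun j => if j == i then v else f j.

Lemma fput_same (T : Type) (f : nat -> T) i v : fput f i v i = v.
Proof. by rewrite /fput eqxx. Qed.

Lemma fput_other (T : Type) (f : nat -> T) i v j : j != i -> fput f i v j = f j.
Proof. by rewrite /fput => /negbTE ->. Qed.

Lemma fput_id (T : Type) (f : nat -> T) i : fput f i (f i) = f.
Proof. by apply/funext => j; rewrite /fput; case: eqP => [->|]. Qed.

Lemma fput_fput (T : Type) (f : nat -> T) i u v : fput (fput f i u) i v = fput f i v.
Proof. by apply/funext => j; rewrite /fput; case: eqP. Qed.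

(** * A while-language for Turing machines *)

Inductive tcmd : Type :=
| TAct of (symbols -> symbols) & direction
| TSeq of tcmd & tcmd
| TIf of pred symbols & tcmd & tcmd
| TWhile of pred symbols & tcmd.

(* A test cannot leave the head in place, so it steps right and back; the
   outcome is remembered in a state [Some b] meanwhile. *)
Fixpoint tstate (c : tcmd) : finType :=
  match c with
  | TAct _ _ => unit
  | TSeq a b => (tstate a + tstate b)%type
  | TIf _ a b => (option bool + (tstate a + tstate b))%type
  | TWhile _ a => (option bool + tstate a)%type
  end.

Fixpoint tentry (c : tcmd) : tstate c :=
  match c with
  | TAct _ _ => tt
  | TSeq a b => inl (tentry a)
  | TIf _ a b => inl None
  | TWhile _ a => inl None
  end.

(** The outcome [None] means that control leaves the command, so that the enclosing command can plug
    in its next entry point. *)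
Fixpoint tdelta (c : tcmd) :
    tstate c -> symbols -> option (tstate c) * symbols * direction :=
  match c with
  | TAct f d => fun _ s => (None, f s, d)
  | TSeq a b => fun q s =>
      match q with
      | inl q => let: (o, s', d) := tdelta q s in
                 (Some (oapp inl (inr (tentry b)) o), s', d)
      | inr q => let: (o, s', d) := tdelta q s in (omap inr o, s', d)
      end
  | TIf p a b => fun q s =>
      match q with
      | inl None => (Some (inl (Some (p s))), s, go_right)
      | inl (Some true) => (Some (inr (inl (tentry a))), s, go_left)
      | inl (Some false) => (Some (inr (inr (tentry b))), s, go_left)
      | inr (inl q) => let: (o, s', d) := tdelta q s in
                       (omap (inr \o inl) o, s', d)
      | inr (inr q) => let: (o, s', d) := tdelta q s in
                       (omap (inr \o inr) o, s', d)
      end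
  | TWhile p a => fun q s =>
      match q with
      | inl None => (Some (inl (Some (p s))), s, go_right)
      | inl (Some true) => (Some (inr (tentry a)), s, go_left)
      | inl (Some false) => (None, s, go_left)
      | inr q => let: (o, s', d) := tdelta q s in
                 (Some (oapp inr (inl None) o), s', d)
      end
  end.

(* [J] holds of every tape met during the execution. *)
Inductive texec (J : tape -> Prop) : tcmd -> nat * tape -> nat * tape -> Prop :=
| XAct f d h t : J (fput t h (f (t h))) ->
    texec J (TAct f d) (h, t) (move_head d h, fput t h (f (t h)))
| XSeq a b u v w : texec J a u v -> texec J b v w -> texec J (TSeq a b) u w
| XIf (p : pred symbols) a b h t v : J t -> texec J (if p (t h) then a else b) (h, t) v ->
    texec J (TIf p a b) (h, t) v
| XWhileF (p : pred symbols) a h t : J t -> ~~ p (t h) -> texec J (TWhile p a) (h, t) (h, t)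
| XWhileT (p : pred symbols) a h t v w : J t -> p (t h) -> texec J a (h, t) v ->
    texec J (TWhile p a) v w -> texec J (TWhile p a) (h, t) w.

(** * Running a compiled command inside the control of a machine *)

Section Machine.
Variables (S : Type) (delta : S -> symbols -> S * symbols * direction).

Definition tm_step (c : S * nat * tape) : S * nat * tape :=
  let: (q, h, t) := c in
  let: (q', s, d) := delta q (t h) in (q', move_head d h, fput t h s).

(** At least one step is made, which makes the times of a schedule strictly increasing. The starting
    tape is left to the segment that leads to it. *)
Definition reach (J : tape -> Prop) (c c' : S * nat * tape) : Prop :=
  exists n, iter n.+1 tm_step c = c' /\
    forall m, m <= n -> J (iter m.+1 tm_step c).2.

Lemma reach_step J c : J (tm_step c).2 -> reach J c (tm_step c).
Proof. by move=> Jc; exists 0; split=> // -[]. Qed.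

Lemma reach_trans J a b c : reach J a b -> reach J b c -> reach J a c.
Proof.
move=> [n [nb Jn]] [k [kc Jk]]; exists (k.+1 + n); split.
  by rewrite -addnS iterD nb.
move=> m mk; case: (leqP m n) => [|nm]; first exact: Jn.
have -> : m.+1 = (m - n.+1).+1 + n.+1 by lia.
by rewrite iterD nb; apply: Jk; lia.
Qed.

(** The command sits inside a larger control: its states are renamed by [e] and its exit is wired to
    [x]. *)
Definition embeds (c : tcmd) (e : tstate c -> S) (x : S) : Prop :=
  forall q s, delta (e q) s =
    let: (o, s', d) := tdelta q s in (oapp e x o, s', d).

Lemma embeds_seq a b e x : embeds (c := TSeq a b) e x ->
  embeds (e \o inl) (e (inr (tentry b))) /\ embeds (e \o inr) x.
Proof.
move=> E; split=> q s; rewrite E /=.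
  by case: (tdelta q s) => [[[o|] s'] d].
by case: (tdelta q s) => [[[o|] s'] d].
Qed.

Lemma embeds_if p a b e x : embeds (c := TIf p a b) e x ->
  embeds (e \o inr \o inl) x /\ embeds (e \o inr \o inr) x.
Proof.
by move=> E; split=> q s; rewrite E /=; case: (tdelta q s) => [[[o|] s'] d].
Qed.

Lemma embeds_while p a e x : embeds (c := TWhile p a) e x ->
  embeds (e \o inr) (e (inl None)).
Proof. by move=> E q s; rewrite E /=; case: (tdelta q s) => [[[o|] s'] d]. Qed.

Lemma reach_if p a b e x J h t : embeds (c := TIf p a b) e x -> J t ->
  reach J (e (inl None), h, t)
    (if p (t h) then (e (inr (inl (tentry a))), h, t)
                else (e (inr (inr (tentry b))), h, t)).
Proof.
move=> E Jt.
have s1 : tm_step (e (inl None), h, t) = (e (inl (Some (p (t h)))), h.+1, t).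
  by rewrite /tm_step E /= fput_id.
have := reach_step (J := J) (c := (e (inl None), h, t)).
rewrite s1 => /(_ Jt) r1; apply: reach_trans r1 _.
have s2 : tm_step (e (inl (Some (p (t h)))), h.+1, t) =
    if p (t h) then (e (inr (inl (tentry a))), h, t)
                else (e (inr (inr (tentry b))), h, t).
  by rewrite /tm_step E /=; case: (p (t h)); rewrite /= fput_id.
rewrite -s2; apply: reach_step; rewrite s2; by case: ifP.
Qed.

Lemma reach_while p a e x J h t : embeds (c := TWhile p a) e x -> J t ->
  reach J (e (inl None), h, t)
    (if p (t h) then (e (inr (tentry a)), h, t) else (x, h, t)).
Proof.
move=> E Jt.
have s1 : tm_step (e (inl None), h, t) = (e (inl (Some (p (t h)))), h.+1, t).
  by rewrite /tm_step E /= fput_id.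
have := reach_step (J := J) (c := (e (inl None), h, t)).
rewrite s1 => /(_ Jt) r1; apply: reach_trans r1 _.
have s2 : tm_step (e (inl (Some (p (t h)))), h.+1, t) =
    if p (t h) then (e (inr (tentry a)), h, t) else (x, h, t).
  by rewrite /tm_step E /=; case: (p (t h)); rewrite /= fput_id.
rewrite -s2; apply: reach_step; rewrite s2; by case: ifP.
Qed.

Lemma texec_reach J c u v : texec J c u v -> forall e x, embeds (c := c) e x ->
  reach J (e (tentry c), u.1, u.2) (x, v.1, v.2).
Proof.
elim=> {c u v} [f d h t Jt|a b u v w _ IHa _ IHb|p a b h t v Jt _ IH
  |p a h t Jt np|p a h t v w Jt pt _ IHa _ IHw] e x E.
- have s1 : tm_step (e (tentry (TAct f d)), h, t) =
     (x, move_head d h, fput t h (f (t h))) by rewrite /tm_step E.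
  by rewrite -s1; apply: reach_step; rewrite s1.
- have [Ea Eb] := embeds_seq E.
  exact: reach_trans (IHa _ _ Ea) (IHb _ _ Eb).
- have [Ea Eb] := embeds_if E.
  apply: reach_trans (reach_if h E Jt) _.
  by move: IH; case: (p (t h)) => IH; [apply: IH Ea|apply: IH Eb].
- by have := reach_while h E Jt; rewrite (negbTE np).
- have := reach_while h E Jt; rewrite pt => r1; apply: reach_trans r1 _.
  exact: reach_trans (IHa _ _ (embeds_while E)) (IHw _ _ E).
Qed.
End Machine.

(** * Register machines with an array of symbols *)

Definition bit (j : nat) (s : symbols) : bool :=
  match j with 0 => s.1.1 | 1 => s.1.2 | _ => s.2 end.

Definition set_bit (j : nat) (v : bool) (s : symbols) : symbols :=
  match j with
  | 0 => (v, s.1.2, s.2) | 1 => (s.1.1, v, s.2) | _ => (s.1.1, s.1.2, v)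
  end.

Lemma symbols_ext (s s' : symbols) : (forall j, bit j s = bit j s') -> s = s'.
Proof.
by case: s s' => [[a b] c] [[a' b'] c'] E; move: (E 0) (E 1) (E 2) => /= -> -> ->.
Qed.

Inductive cmd : Type :=
| Skip
| Inc of nat
| Dec of nat
| Seq of cmd & cmd
| While of nat & cmd
| IfReg of nat & cmd & cmd
| IfBit of nat & nat & cmd & cmd
| Write of nat & nat & bool.

Definition mem : Type := ((nat -> nat) * tape)%type.

(** There is no rule for decrementing a zero register, since the compiled [Dec] steps back one block
    from the end of the numeral. The predicate [I] holds of every array met. *)
Inductive exec (I : tape -> Prop) : cmd -> mem -> mem -> Prop :=
| ESkip r X : I X -> exec I Skip (r, X) (r, X)
| EInc x r X : I X -> exec I (Inc x) (r, X) (fput r x (r x).+1, X)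
| EDec x n r X : I X -> r x = n.+1 -> exec I (Dec x) (r, X) (fput r x n, X)
| ESeq a b u v w : exec I a u v -> exec I b v w -> exec I (Seq a b) u w
| EWhile0 x a r X : I X -> r x = 0 -> exec I (While x a) (r, X) (r, X)
| EWhileS x n a r X v w : I X -> r x = n.+1 -> exec I a (r, X) v ->
    exec I (While x a) v w -> exec I (While x a) (r, X) w
| EIfReg x a b r X v : I X ->
    exec I (if r x != 0 then a else b) (r, X) v -> exec I (IfReg x a b) (r, X) v
| EIfBit j x a b r X v : I X ->
    exec I (if bit j (X (r x)) then a else b) (r, X) v ->
    exec I (IfBit j x a b) (r, X) v
| EWrite j x b r X : I X -> I (fput X (r x) (set_bit j b (X (r x)))) ->
    exec I (Write j x b) (r, X) (r, fput X (r x) (set_bit j b (X (r x)))).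

Fixpoint regs_below (K : nat) (c : cmd) : bool :=
  match c with
  | Skip => true
  | Inc x | Dec x | Write _ x _ => x < K
  | Seq a b => regs_below K a && regs_below K b
  | While x a => (x < K) && regs_below K a
  | IfReg x a b | IfBit _ x a b => [&& x < K, regs_below K a & regs_below K b]
  end.

Lemma regs_below_mono K L c : K <= L -> regs_below K c -> regs_below L c.
Proof.
move=> KL; elim: c => //=; intros; repeat match goal with
 | H : is_true (_ && _) |- _ => case/andP: H => *
 | |- is_true (_ && _) => apply/andP; split end; auto; try lia.
Qed.

Lemma regs_below_ex c : exists K, regs_below K c.
Proof.
elim: c => /= [|x|x|a [K Ka] b [L Lb]|x a [K Ka]|x a [K Ka] b [L Lb]
  |j x a [K Ka] b [L Lb]|j x v]; try by [exists 0|exists x.+1].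
- exists (maxn K L); apply/andP; split.
    by apply: regs_below_mono Ka; lia.
  by apply: regs_below_mono Lb; lia.
- exists (maxn K x.+1); apply/andP; split; first by lia.
  by apply: regs_below_mono Ka; lia.
- exists (maxn x.+1 (maxn K L)); apply/and3P; split; first by lia.
    by apply: regs_below_mono Ka; lia.
  by apply: regs_below_mono Lb; lia.
- exists (maxn x.+1 (maxn K L)); apply/and3P; split; first by lia.
    by apply: regs_below_mono Ka; lia.
  by apply: regs_below_mono Lb; lia.
Qed.

Definition tskip : tcmd := TSeq (TAct id go_right) (TAct id go_left).

Fixpoint tmove (d : direction) (n : nat) : tcmd :=
  if n is n'.+1 then TSeq (TAct id d) (tmove d n') else tskip.

Definition tpoke (f : symbols -> symbols) : tcmd :=
  TSeq (TAct f go_right) (TAct id go_left).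

Section Exec.
Variable J : tape -> Prop.

Lemma texec_move1 d h t : J t -> texec J (TAct id d) (h, t) (move_head d h, t).
Proof. by move=> Jt; rewrite -{2}(fput_id t h); apply: XAct; rewrite fput_id. Qed.

Lemma texec_skip h t : J t -> texec J tskip (h, t) (h, t).
Proof.
by move=> Jt; apply: XSeq (texec_move1 _ _ Jt) _; apply: (texec_move1 go_left).
Qed.

Lemma texec_right n h t : J t -> texec J (tmove go_right n) (h, t) (h + n, t).
Proof.
move=> Jt; elim: n h => [|n IH] h /=; first by rewrite addn0; apply: texec_skip.
by apply: XSeq (texec_move1 _ _ Jt) _; rewrite addnS -addSn; apply: IH.
Qed.

Lemma texec_left n h t : J t -> texec J (tmove go_left n) (h + n, t) (h, t).
Proof.
move=> Jt; elim: n h => [|n IH] h /=; first by rewrite addn0; apply: texec_skip.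
by rewrite addnS; apply: XSeq (texec_move1 go_left (h + n).+1 Jt) (IH h).
Qed.

Lemma texec_poke f h t : J (fput t h (f (t h))) ->
  texec J (tpoke f) (h, t) (h, fput t h (f (t h))).
Proof. by move=> Jt; apply: XSeq (@XAct J f go_right h t Jt) (texec_move1 go_left h.+1 Jt). Qed.
End Exec.
Arguments tmove : simpl never.

(* Cells are grouped in blocks of [K.+1].  The first cell of block [n] holds
   the symbol [X n] on the three tapes; cell [x.+1] of the blocks holds register
   [x] on tape 1, as the number of blocks before the first 0.  What lies beyond
   that 0 is arbitrary, because limit stages leave junk there.  On tape 2, a 1
   in cell [1] of a block marks block 0. *)
Section Layout.
Variable K : nat.
Local Notation B := K.+1.

Definition array_of (t : tape) : tape := fun n => t (B * n).

Definition clean (t : tape) : Prop := forall n, bit 1 (t (B * n.+1 + 1)) = false.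

Definition represents (r : nat -> nat) (X : tape) (t : tape) : Prop :=
  [/\ array_of t = X, clean t, bit 1 (t 1) &
      forall x, x < K -> bit 0 (t (B * r x + x.+1)) = false /\
        forall n, n < r x -> bit 0 (t (B * n + x.+1))].

(** What has to hold at every stage in order to survive a limit. Registers and the mark of block 0
    are left out because they are rewritten at the beginning of each block. *)
Definition safe (I : tape -> Prop) (t : tape) : Prop := clean t /\ I (array_of t).

Lemma represents_safe (I : tape -> Prop) r X t :
  represents r X t -> I X -> safe I t.
Proof. by case=> <-. Qed.

Lemma block_addr_inj n m x y : x < B -> y < B -> B * n + x = B * m + y ->
  n = m /\ x = y.
Proof.
move=> xB yB E; have nm : n = m.
  have := congr1 (divn^~ B) E.
  by rewrite ![B * _]mulnC !divnMDl // !divn_small // !addn0.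
by subst m; lia.
Qed.

Lemma block_addr_eq n m x y : x < B -> y < B ->
  (B * n + x == B * m + y) = (n == m) && (x == y).
Proof.
move=> xB yB; apply/eqP/andP => [/(block_addr_inj xB yB) [-> ->] //|].
by case=> /eqP -> /eqP ->.
Qed.

Definition reg_write (n x : nat) (v : bool) (t : tape) : tape :=
  fput t (B * n + x.+1) (set_bit 0 v (t (B * n + x.+1))).

Section RegWrite.
Variables (n x : nat) (v : bool) (t : tape) (xK : x < K).

Lemma array_of_reg_write : array_of (reg_write n x v t) = array_of t.
Proof.
apply/funext => m; rewrite /array_of /reg_write /fput -[B * m]addn0.
by rewrite block_addr_eq // andbF.
Qed.

Lemma bit1_reg_write m : bit 1 (reg_write n x v t m) = bit 1 (t m).
Proof. by rewrite /reg_write /fput; case: eqP => [->|]. Qed.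

Lemma bit0_reg_write m y : y < K -> bit 0 (reg_write n x v t (B * m + y.+1)) =
  if (m == n) && (y == x) then v else bit 0 (t (B * m + y.+1)).
Proof.
by move=> yK; rewrite /reg_write /fput block_addr_eq // eqSS; case: ifP.
Qed.

Lemma safe_reg_write I : safe I t -> safe I (reg_write n x v t).
Proof.
by case=> ct It; split; [move=> m; rewrite bit1_reg_write|rewrite array_of_reg_write].
Qed.
End RegWrite.

(** The cell after the lengthened numeral may hold junk, hence the second write, which puts the
    terminating 0 there. *)
Lemma represents_inc r X t x n : x < K -> r x = n -> represents r X t ->
  represents (fput r x n.+1) X (reg_write n.+1 x false (reg_write n x true t)).
Proof.
move=> xK rx [A C M R]; split.
- by rewrite !array_of_reg_write.
- by move=> m; rewrite !bit1_reg_write.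
- by rewrite !bit1_reg_write.
move=> y yK; have [R0 R1] := R y yK; rewrite /fput; split.
  rewrite !bit0_reg_write //; case: (eqVneq y x) => [->|yx].
    by rewrite eqxx.
  by rewrite !andbF.
move=> m; rewrite !bit0_reg_write //; case: (eqVneq y x) => [yx|yx] mn.
  subst y; rewrite !andbT ifN; last by lia.
  by case: eqP => // mn'; apply: R1; lia.
by rewrite !andbF; apply: R1.
Qed.

Lemma represents_dec r X t x n : x < K -> r x = n.+1 -> represents r X t ->
  represents (fput r x n) X (reg_write n x false t).
Proof.
move=> xK rx [A C M R]; split.
- by rewrite !array_of_reg_write.
- by move=> m; rewrite !bit1_reg_write.
- by rewrite !bit1_reg_write.
move=> y yK; have [R0 R1] := R y yK; rewrite /fput; split.
  rewrite !bit0_reg_write //; case: (eqVneq y x) => [->|yx].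
    by rewrite eqxx.
  by rewrite !andbF.
move=> m; rewrite !bit0_reg_write //; case: (eqVneq y x) => [yx|yx] mn.
  subst y; rewrite !andbT ifN; last by lia.
  by apply: R1; lia.
by rewrite !andbF; apply: R1.
Qed.

Lemma represents_write r X t n f : 0 < K -> represents r X t ->
  represents r (fput X n (f (X n))) (fput t (B * n) (f (t (B * n)))).
Proof.
move=> K0 [<- C M R].
have E m y : y < K -> fput t (B * n) (f (t (B * n))) (B * m + y.+1) = t (B * m + y.+1).
  by move=> yK; rewrite /fput -[B * n]addn0 block_addr_eq // andbF.
split.
- apply/funext => m; rewrite /array_of /fput.
  by rewrite eqn_pmul2l //; case: eqP => // ->.
- by move=> m; rewrite E.
- by have := E 0 0 K0; rewrite muln0 => ->.
- by move=> y yK; have [R0 R1] := R y yK; split=> [|m]; rewrite E //; apply: R1.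
Qed.

Definition tgoto (x : nat) : tcmd :=
  TSeq (tmove go_right x.+1) (TWhile (bit 0) (tmove go_right B)).

(** Started in cell 1 of any block, the head jumps back by whole blocks until it sees the mark of
    block 0. On a [clean] tape no stray mark stops it early. *)
Definition thome : tcmd :=
  TSeq (TWhile (fun s => ~~ bit 1 s) (tmove go_left B)) (TAct id go_left).

Fixpoint compile (c : cmd) : tcmd :=
  match c with
  | Skip => tskip
  | Inc x =>
      TSeq (tgoto x) (TSeq (tpoke (set_bit 0 true)) (TSeq (tmove go_right B)
        (TSeq (tpoke (set_bit 0 false)) (TSeq (tmove go_left x) thome))))
  | Dec x =>
      TSeq (tgoto x) (TSeq (tmove go_left B)
        (TSeq (tpoke (set_bit 0 false)) (TSeq (tmove go_left x) thome)))
  | Seq a b => TSeq (compile a) (compile b)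
  | While x a =>
      TSeq (tmove go_right x.+1) (TSeq
        (TWhile (bit 0) (TSeq (tmove go_left x.+1)
          (TSeq (compile a) (tmove go_right x.+1))))
        (tmove go_left x.+1))
  | IfReg x a b =>
      TSeq (tmove go_right x.+1) (TIf (bit 0)
        (TSeq (tmove go_left x.+1) (compile a))
        (TSeq (tmove go_left x.+1) (compile b)))
  | IfBit j x a b =>
      TSeq (tgoto x) (TSeq (tmove go_left x.+1) (TIf (bit j)
        (TSeq (tmove go_right 1) (TSeq thome (compile a)))
        (TSeq (tmove go_right 1) (TSeq thome (compile b)))))
  | Write j x v =>
      TSeq (tgoto x) (TSeq (tmove go_left x.+1) (TSeq (tpoke (set_bit j v))
        (TSeq (tmove go_right 1) thome)))
  end.

(** * Correctness of the compilation to Turing machines *)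

Section Compile.
Variable I : tape -> Prop.
Local Notation J := (safe I).

Lemma texec_goto r X t x : represents r X t -> I X -> x < K ->
  texec J (tgoto x) (0, t) (B * r x + x.+1, t).
Proof.
move=> Rt IX xK; have Jt := represents_safe Rt IX.
case: Rt => _ _ _ /(_ x xK) [R0 R1].
apply: XSeq (texec_right _ _ Jt) _.
suff W m n : n + m = r x -> texec J (TWhile (bit 0) (tmove go_right B))
    (B * n + x.+1, t) (B * r x + x.+1, t).
  by have := W (r x) 0 erefl; rewrite muln0.
elim: m n => [|m IH] n E.
  by rewrite -E addn0; apply: XWhileF => //; rewrite -[n]addn0 E R0.
apply: XWhileT Jt (R1 _ _) (texec_right _ _ Jt) _; first by lia.
have -> : B * n + x.+1 + B = B * n.+1 + x.+1 by lia.
by apply: IH; lia.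
Qed.

Lemma texec_home t n : J t -> bit 1 (t 1) -> texec J thome (B * n + 1, t) (0, t).
Proof.
move=> Jt M; case: (Jt) => C _; apply: XSeq (texec_move1 go_left 1 Jt).
elim: n => [|n IH]; first by rewrite muln0; apply: XWhileF; rewrite ?M.
apply: XWhileT IH => //; first by rewrite C.
have -> : B * n.+1 + 1 = B * n + 1 + B by lia.
exact: texec_left.
Qed.

Lemma texec_return t n x : J t -> bit 1 (t 1) ->
  texec J (TSeq (tmove go_left x) thome) (B * n + x.+1, t) (0, t).
Proof.
move=> Jt M; apply: XSeq (texec_home n Jt M).
have -> : B * n + x.+1 = B * n + 1 + x by lia.
exact: texec_left.
Qed.

Lemma texec_array_home t n : J t -> bit 1 (t 1) ->
  texec J (TSeq (tmove go_right 1) thome) (B * n, t) (0, t).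
Proof. by move=> Jt M; apply: XSeq (texec_right _ _ Jt) (texec_home n Jt M). Qed.

Lemma texec_goto_array r X t x : represents r X t -> I X -> x < K ->
  texec J (TSeq (tgoto x) (tmove go_left x.+1)) (0, t) (B * r x, t).
Proof.
move=> Rt IX xK; apply: XSeq (texec_goto Rt IX xK) _.
exact: texec_left _ _ (represents_safe Rt IX).
Qed.

Lemma texec_seqA a b c u v : texec J (TSeq (TSeq a b) c) u v ->
  texec J (TSeq a (TSeq b c)) u v.
Proof.
move=> H; inversion_clear H; inversion_clear H0.
by apply: XSeq; first eassumption; apply: XSeq; eassumption.
Qed.

Lemma bit0_reg r X t x : represents r X t -> x < K ->
  bit 0 (t x.+1) = (r x != 0).
Proof.
case=> _ _ _ R xK; case: (R x xK) => R0 R1.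
case: (posnP (r x)) => [r0|r0].
  by move: R0; rewrite r0 muln0 add0n => ->.
by have := R1 0 r0; rewrite muln0 add0n => ->.
Qed.

(** Compiled commands start and end with the head on cell 0, so their executions chain. Register
    writes touch neither array cells nor marks, and array writes avoid the marked cells, so [I] on
    arrays becomes [safe I] on tapes. *)
Lemma texec_compile c u v : 0 < K -> exec I c u v -> regs_below K c ->
  forall t, represents u.1 u.2 t -> I v.2 /\
  exists t', represents v.1 v.2 t' /\ texec J (compile c) (0, t) (0, t').
Proof.
move=> K0; elim=> {c u v}.
- move=> r X IX _ t Rt; split=> //; exists t; split=> //.
  exact: texec_skip _ (represents_safe Rt IX).
- move=> x r X IX /= xK t Rt; split=> //; eexists.
  have Rt' := represents_inc xK erefl Rt; split; first exact: Rt'.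
  have Jt := represents_safe Rt IX.
  have Jt1 := safe_reg_write (r x) true xK Jt.
  have Jt2 := safe_reg_write (r x).+1 false xK Jt1.
  apply: XSeq (texec_goto Rt IX xK) _.
  apply: XSeq; first exact: texec_poke Jt1.
  apply: XSeq; first exact: texec_right _ _ Jt1.
  have -> : B * r x + x.+1 + B = B * (r x).+1 + x.+1 by lia.
  apply: XSeq; first exact: texec_poke Jt2.
  by apply: texec_return => //; case: Rt'.
- move=> x n r X IX rx /= xK t Rt; split=> //; eexists.
  have Rt' := represents_dec xK rx Rt; split; first exact: Rt'.
  have Jt := represents_safe Rt IX.
  have Jt1 := safe_reg_write n false xK Jt.
  apply: XSeq (texec_goto Rt IX xK) _.
  apply: XSeq; last apply: XSeq; last 1 first.
  + by apply: (texec_return n _ Jt1); case: Rt'.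
  + have -> : B * r x + x.+1 = B * n + x.+1 + B by lia.
    exact: texec_left _ _ Jt.
  + exact: texec_poke Jt1.
- move=> a b u v w _ IHa _ IHb /= /andP [wa wb] t Rt.
  have [Iv [t1 [Rt1 E1]]] := IHa wa t Rt.
  have [Iw [t2 [Rt2 E2]]] := IHb wb t1 Rt1.
  by split=> //; exists t2; split=> //; apply: XSeq E1 E2.
- move=> x a r X IX r0 /= /andP [xK wa] t Rt; split=> //; exists t; split=> //.
  have Jt := represents_safe Rt IX.
  apply: XSeq (texec_right _ _ Jt) _; rewrite add0n.
  apply: XSeq (texec_left _ 0 Jt).
  by apply: XWhileF => //; rewrite (bit0_reg Rt xK) r0.
- move=> x n a r X v w IX rx _ IHa _ IHw /= /andP [xK wa] t Rt.
  have Jt := represents_safe Rt IX.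
  have [Iv [t1 [Rt1 E1]]] := IHa wa t Rt.
  have [|Iw [t2 [Rt2 E2]]] := IHw _ t1 Rt1; first by rewrite /= xK.
  have Jt1 := represents_safe Rt1 Iv.
  split=> //; exists t2; split=> //.
  apply: XSeq (texec_right _ _ Jt) _; rewrite add0n.
  (* The execution of the remaining loop is taken apart: its opening move to the register cell
     becomes the end of the iteration just made. *)
  inversion_clear E2; inversion_clear H0.
  apply: XSeq; last exact: H2.
  apply: XWhileT => //; first by rewrite (bit0_reg Rt xK) rx.
    apply: XSeq (texec_left _ 0 Jt) _.
    apply: XSeq E1 _; exact: H.
  exact: H1.
- move=> x a b r X v IX _ IH /= /and3P [xK wa wb] t Rt.
  have Jt := represents_safe Rt IX.
  have [|Iv [t1 [Rt1 E1]]] := IH _ t Rt; first by case: ifP.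
  split=> //; exists t1; split=> //.
  apply: XSeq (texec_right _ _ Jt) _; rewrite add0n.
  apply: XIf => //; rewrite (bit0_reg Rt xK).
  by move: E1; case: ifP => _ E1; apply: XSeq (texec_left _ 0 Jt) E1.
- move=> j x a b r X v IX _ IH /= /and3P [xK wa wb] t Rt.
  have Jt := represents_safe Rt IX.
  have [|Iv [t1 [Rt1 E1]]] := IH _ t Rt; first by case: ifP.
  split=> //; exists t1; split=> //.
  apply: texec_seqA; apply: XSeq (texec_goto_array Rt IX xK) _.
  case: (Rt) => /= EX _ M _.
  apply: XIf => //; move: E1; rewrite -EX /array_of.
  by case: ifP => _ E1; apply: texec_seqA; apply: XSeq (texec_array_home _ Jt M) E1.
- move=> j x b r X IX IX' /= xK t Rt; split=> //.
  have Jt := represents_safe Rt IX.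
  have Rt' := represents_write (r x) (set_bit j b) K0 Rt.
  have Jt' := represents_safe Rt' IX'.
  eexists; split; first exact: Rt'.
  apply: texec_seqA; apply: XSeq (texec_goto_array Rt IX xK) _.
  apply: XSeq; first exact: texec_poke Jt'.
  by apply: texec_array_home => //; case: Rt'.
Qed.
End Compile.

(** * Initialising the registers on a tape left by a limit stage *)

Definition reset_cell (x : nat) (s : symbols) : symbols := (false, x == 0, s.2).

Fixpoint treset (n x : nat) : tcmd :=
  if n is n'.+1 then TSeq (TAct (reset_cell x) go_right) (treset n' x.+1)
  else tmove go_left x.+1.

(** Clearing the register cells of block 0 is enough: a numeral ends at its first 0, so all
    registers become 0 whatever junk lies further right. The same pass writes the mark of block
    0. *)
Definition tinit : tcmd := TSeq (TAct id go_right) (treset K 0).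

Lemma texec_init I t : 0 < K -> safe I t -> exists t',
  represents (fun=> 0) (array_of t) t' /\ texec (safe I) tinit (0, t) (0, t').
Proof.
move=> K0 Jt.
suff W n x t0 : n + x = K -> safe I t0 -> array_of t0 = array_of t ->
    (forall y, y < x -> bit 0 (t0 y.+1) = false /\ bit 1 (t0 y.+1) = (y == 0)) ->
    exists t', represents (fun=> 0) (array_of t) t' /\
      texec (safe I) (treset n x) (x.+1, t0) (0, t').
  have [|//|//|//|t' [Rt' E]] := W K 0 t; first by rewrite addn0.
  exists t'; split=> //; exact: XSeq (texec_move1 go_right 0 Jt) E.
elim: n x t0 => [|n IH] x t0 nx J0 A0 H0 /=.
  exists t0; split; last exact: (texec_left (J := safe I) x.+1 0).
  split=> //; first by case: J0.
    by have [] := H0 0; lia.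
  by move=> y yK; rewrite muln0; split=> //; apply: (H0 y _).1; lia.
have xK : x < K by lia.
have E m y : y < K.+1 -> (m != 0) || (y != x.+1) ->
    fput t0 x.+1 (reset_cell x (t0 x.+1)) (B * m + y) = t0 (B * m + y).
  move=> yK my; rewrite /fput.
  have -> : x.+1 = B * 0 + x.+1 by rewrite muln0.
  by rewrite block_addr_eq // ifN // negb_and.
have A1 : array_of (fput t0 x.+1 (reset_cell x (t0 x.+1))) = array_of t.
  by rewrite -A0; apply/funext => m; rewrite /array_of -[B * m]addn0 E ?orbT.
have J1 : safe I (fput t0 x.+1 (reset_cell x (t0 x.+1))).
  case: J0 => C0 I0; split; last by rewrite A1 -A0.
  by move=> m; rewrite E.
have [||||t' [Rt' T]] := IH x.+1 (fput t0 x.+1 (reset_cell x (t0 x.+1))).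
- by lia.
- exact: J1.
- exact: A1.
- move=> y; rewrite ltnS leq_eqVlt => /orP [/eqP -> |yx].
    by rewrite fput_same.
  by rewrite fput_other; [apply: H0|lia].
by exists t'; split=> //; apply: XSeq T; apply: XAct.
Qed.
End Layout.

(** * Primitive recursive functions on register machines *)

Section Moves.
Variables (I : tape -> Prop) (X : tape) (IX : I X).

Lemma exec_zero x r : exec I (While x (Dec x)) (r, X) (fput r x 0, X).
Proof.
move En: (r x) => n; elim: n r En => [|n IH] r En.
  by rewrite -En fput_id; apply: EWhile0.
apply: EWhileS IX En (EDec IX En) _.
by rewrite -(fput_fput r x n 0); apply: IH; rewrite fput_same.
Qed.

Definition move_reg (a b : nat) : cmd :=
  Seq (While b (Dec b)) (While a (Seq (Dec a) (Inc b))).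

Lemma exec_move a b r : a != b ->
  exec I (move_reg a b) (r, X) (fput (fput r b (r a)) a 0, X).
Proof.
move=> ab; apply: ESeq (exec_zero _ _) _.
suff W n m s : s a = n -> s b = m -> exec I (While a (Seq (Dec a) (Inc b)))
    (s, X) (fput (fput s b (n + m)) a 0, X).
  have := W (r a) 0 (fput r b 0); rewrite fput_other // fput_same addn0 fput_fput.
  exact.
elim: n m s => [|n IH] m s sa sb.
  by rewrite -sb fput_id -sa fput_id; apply: EWhile0.
apply: EWhileS IX sa (ESeq (EDec IX sa) (EInc b _ IX)) _.
rewrite fput_other 1?eq_sym // sb.
have -> : fput (fput s b (n.+1 + m)) a 0 =
    fput (fput (fput (fput s a n) b m.+1) b (n + m.+1)) a 0.
  apply/funext => j; rewrite /fput; do 2!case: (j =P _) => // _; lia.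
by apply: IH; rewrite ?fput_same // fput_other // fput_same.
Qed.

Definition copy_reg (i a b : nat) : cmd :=
  Seq (While a (Dec a)) (Seq (While b (Dec b))
    (Seq (While i (Seq (Dec i) (Seq (Inc a) (Inc b)))) (move_reg b i))).

Lemma exec_copy i a b r : i != a -> i != b -> a != b ->
  exec I (copy_reg i a b) (r, X) (fput (fput r a (r i)) b 0, X).
Proof.
move=> ia ib ab; apply: ESeq (exec_zero _ _) _; apply: ESeq (exec_zero _ _) _.
have W n m s : s i = n -> s a = m -> s b = m ->
    exec I (While i (Seq (Dec i) (Seq (Inc a) (Inc b)))) (s, X)
      (fput (fput (fput s a (n + m)) b (n + m)) i 0, X).
  elim: n m s => [|n IH] m s si sa sb.
    by rewrite -{1}sa -sb !fput_id -si fput_id; apply: EWhile0.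
  apply: (EWhileS IX si (ESeq (EDec IX si) (ESeq (EInc a _ IX) (EInc b _ IX)))).
  set s1 := fput (fput _ _ _) _ _.
  have [s1i s1a s1b] : [/\ s1 i = n, s1 a = m.+1 & s1 b = m.+1].
    by rewrite /s1 /fput !eqxx (negbTE ia) (negbTE ib) (negbTE ab)
      (eq_sym b) (negbTE ab) (eq_sym a i) (eq_sym b i) (negbTE ia) (negbTE ib) sa sb.
  have := IH m.+1 s1 s1i s1a s1b; rewrite -!addSnnS.
  congr exec; congr pair; apply/funext => j; rewrite /s1 /fput.
  by case: (j =P i) => // ji; case: (j =P b) => // jb; case: (j =P a).
set s0 := fput (fput _ _ _) _ _.
have s0i : s0 i = r i by rewrite /s0 /fput (negbTE ia) (negbTE ib).
have s0a : s0 a = 0 by rewrite /s0 /fput (negbTE ab) eqxx.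
have s0b : s0 b = 0 by rewrite /s0 /fput eqxx.
apply: ESeq (W (r i) 0 s0 s0i s0a s0b) _; rewrite addn0.
set s2 := (Y in exec _ _ (Y, _)).
have := @exec_move b i s2; rewrite eq_sym => /(_ ib); congr exec; congr pair.
apply/funext => j; rewrite /s2 /s0 /fput.
case: (j =P b) => // jb; case: (j =P i) => [->|//].
  by rewrite !eqxx (eq_sym b) (negbTE ib) (negbTE ia).
by case: (j =P a).
Qed.
End Moves.

Definition computes (c : cmd) (r : nat) (f : (nat -> nat) -> nat) : Prop :=
  forall I s X, I X -> exists s', [/\ exec I c (s, X) (s', X), s' r = f s &
    forall z, z < r -> s' z = s z].

(* Stack discipline: registers below [k] are the variables; the value is put
   in an arbitrary register [r >= k], and registers above [r] are scratch. *)
Definition computable (k : nat) (f : (nat -> nat) -> nat) : Prop :=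
  (forall s s', (forall z, z < k -> s z = s' z) -> f s = f s') /\
  forall r, k <= r -> exists c, computes c r f.

Lemma computable_ext k f g : computable k f -> f =1 g -> computable k g.
Proof. by move=> cf /funext <-. Qed.

Lemma computable_var k i : i < k -> computable k (fun s => s i).
Proof.
move=> ik; split=> [s s' -> //|r kr]; exists (copy_reg i r r.+1) => I s X IX.
exists (fput (fput s r (s i)) r.+1 0); split.
- by apply: exec_copy => //; lia.
- by rewrite fput_other ?fput_same //; lia.
- by move=> z zr; rewrite !fput_other //; lia.
Qed.

Lemma computable_zero k : computable k (fun=> 0).
Proof.
split=> // r kr; exists (While r (Dec r)) => I s X IX; exists (fput s r 0); split.
- exact: exec_zero.
- exact: fput_same.
- by move=> z zr; rewrite fput_other //; lia.
Qed.

Lemma computable_succ k f : computable k f -> computable k (fun s => (f s).+1).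
Proof.
move=> [df cf]; split=> [s s' /df -> //|r kr]; have [c cc] := cf r kr.
exists (Seq c (Inc r)) => I s X IX; have [s' [e sr sz]] := cc I s X IX.
exists (fput s' r (s' r).+1); split.
- exact: ESeq e (EInc _ _ IX).
- by rewrite fput_same sr.
- by move=> z zr; rewrite fput_other ?sz //; lia.
Qed.

Lemma computable_const k n : computable k (fun=> n).
Proof. by elim: n => [|n /computable_succ //]; apply: computable_zero. Qed.

Definition comp1 (F : nat -> nat) : Prop :=
  forall k i, i < k -> computable k (fun s => F (s i)).
Definition comp2 (F : nat -> nat -> nat) : Prop :=
  forall k i j, i < k -> j < k -> computable k (fun s => F (s i) (s j)).
Definition comp3 (F : nat -> nat -> nat -> nat) : Prop :=
  forall k i j l, i < k -> j < k -> l < k ->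
  computable k (fun s => F (s i) (s j) (s l)).
Definition comp4 (F : nat -> nat -> nat -> nat -> nat) : Prop :=
  forall k i j l m, i < k -> j < k -> l < k -> m < k ->
  computable k (fun s => F (s i) (s j) (s l) (s m)).

(** Composition: the value of [f] becomes a new variable in register [r], [g] is evaluated above it
    and its value is moved down. Functions therefore only need to be programmed with variables as
    arguments. *)
Lemma computable_let k f (g : (nat -> nat) -> nat -> nat) :
  computable k f ->
  (forall s s' a, (forall z, z < k -> s z = s' z) -> g s a = g s' a) ->
  (forall r, k <= r -> computable r.+1 (fun s => g s (s r))) ->
  computable k (fun s => g s (f s)).
Proof.
move=> [df cf] dg cg; split=> [s s' E|r kr]; first by rewrite (df _ _ E); apply: dg.
have [c cc] := cf r kr; have [_ /(_ r.+1 (leqnn _)) [d dd]] := cg r kr.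
exists (Seq c (Seq d (move_reg r.+1 r))) => I s X IX.
have [s1 [e1 s1r s1z]] := cc I s X IX; have [s2 [e2 s2r s2z]] := dd I s1 X IX.
exists (fput (fput s2 r (s2 r.+1)) r.+1 0); split.
- by apply: ESeq e1 (ESeq e2 _); apply: exec_move => //; lia.
- rewrite fput_other ?fput_same ?s2r ?s1r; last by lia.
  by apply: dg => z zk; apply: s1z; lia.
- by move=> z zr; rewrite !fput_other ?s2z ?s1z //; lia.
Qed.

Lemma computable_weak k l f : k <= l -> computable k f -> computable l f.
Proof.
move=> kl [df cf]; split=> [s s' E|r lr]; first by apply: df => z zk; apply: E; lia.
by apply: cf; lia.
Qed.

Lemma computable_app1 F k f : comp1 F -> computable k f ->
  computable k (fun s => F (f s)).
Proof.
move=> cF cf; apply: (computable_let (g := fun s a => F a)) => // r kr.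
by apply: cF; lia.
Qed.

Lemma computable_app2 F k f g : comp2 F -> computable k f -> computable k g ->
  computable k (fun s => F (f s) (g s)).
Proof.
move=> cF cf cg; apply: (computable_let (g := fun s a => F a (g s))) => //.
  by move=> s s' a E; rewrite (cg.1 _ _ E).
move=> r kr; apply: (computable_let (g := fun s a => F (s r) a)).
- by apply: computable_weak cg; lia.
- by move=> s s' a E; rewrite E.
- by move=> r' rr; apply: cF; lia.
Qed.

Lemma computable_app3 F k f g h : comp3 F -> computable k f -> computable k g ->
  computable k h -> computable k (fun s => F (f s) (g s) (h s)).
Proof.
move=> cF cf cg ch; apply: (computable_let (g := fun s a => F a (g s) (h s))) => //.
  by move=> s s' a E; rewrite (cg.1 _ _ E) (ch.1 _ _ E).
move=> r kr; apply: (computable_let (g := fun s a => F (s r) a (h s))).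
- by apply: computable_weak cg; lia.
- move=> s s' a E; rewrite E // (ch.1 s s') // => z zk; apply: E; lia.
move=> r' rr; apply: (computable_let (g := fun s a => F (s r) (s r') a)).
- by apply: computable_weak ch; lia.
- by move=> s s' a E; rewrite !E //; lia.
- by move=> r'' rr'; apply: cF; lia.
Qed.

(** Primitive recursion. Register [r] accumulates the value, [r.+1] counts the index up, [r.+2]
    counts the remaining iterations down, and [r.+3] receives each new value. *)
Lemma comp3_rec (f0 : nat -> nat -> nat) G : comp2 f0 -> comp4 G ->
  comp3 (fun n x y => iteri n (G x y) (f0 x y)).
Proof.
move=> cf cG k n x y nk xk yk; split=> [s s' E|r kr]; first by rewrite !E.
have [_ /(_ r kr) [c0 e0]] := cf k x y xk yk.
have [_ /(_ r.+2 ltac:(lia)) [cn en]] := computable_var nk.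
have := cG r.+3 x y r.+1 r; case; try lia; move=> _ /(_ r.+3 (leqnn _)) [cg eg].
pose body := Seq cg (Seq (move_reg r.+3 r) (Seq (Inc r.+1) (Dec r.+2))).
exists (Seq c0 (Seq cn (Seq (While r.+1 (Dec r.+1)) (While r.+2 body)))) => I s X IX.
have [s1 [e1 s1r s1z]] := e0 I s X IX; have [s2 [e2 s2r s2z]] := en I s1 X IX.
set s3 := fput s2 r.+1 0.
suff W m j s4 : (forall z, z < r -> s4 z = s z) -> m + j = s n ->
    s4 r = iteri j (G (s x) (s y)) (f0 (s x) (s y)) -> s4 r.+1 = j -> s4 r.+2 = m ->
    exists s', [/\ exec I (While r.+2 body) (s4, X) (s', X),
      s' r = iteri (s n) (G (s x) (s y)) (f0 (s x) (s y)) &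
      forall z, z < r -> s' z = s z].
  have [||||| s' [e' s'r s'z]] := W (s n) 0 s3.
  - by move=> z zr; rewrite /s3 fput_other ?s2z ?s1z //; lia.
  - by rewrite addn0.
  - by rewrite /s3 fput_other ?s2z ?s1r //; lia.
  - by rewrite /s3 fput_same.
  - by rewrite /s3 fput_other ?s2r ?s1z //; lia.
  exists s'; split=> //.
  by apply: ESeq e1 (ESeq e2 (ESeq (exec_zero IX _ _) e')).
elim: m j s4 => [|m IH] j s4 s4z mj s4r s4i s4n.
  by exists s4; split=> //; [apply: EWhile0|rewrite -mj].
have [s5 [e5 s5r s5z]] := eg I s4 X IX.
have e6 := exec_move IX (a := r.+3) (b := r) s5 ltac:(lia).
set s6 := fput (fput s5 r (s5 r.+3)) r.+3 0 in e6.
have e7 := EInc r.+1 s6 IX; set s7 := fput s6 _ _ in e7.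
have s7n : s7 r.+2 = m.+1.
  by rewrite /s7 /s6 !fput_other ?s5z //; lia.
have e8 := EDec IX s7n; set s8 := fput s7 _ _ in e8.
have [||||| s' [e' s'r s'z]] := IH j.+1 s8.
- by move=> z zr; rewrite /s8 /s7 /s6 !fput_other ?s5z ?s4z //; lia.
- by lia.
- rewrite /s8 /s7 /s6 fput_other; last by lia.
  rewrite fput_other; last by lia.
  rewrite fput_other; last by lia.
  by rewrite fput_same s5r s4i s4r !s4z //; lia.
- rewrite /s8 fput_other; last by lia.
  by rewrite /s7 fput_same /s6 !fput_other ?s5z ?s4i //; lia.
- by rewrite /s8 fput_same.
exists s'; split=> //.
by apply: EWhileS IX s4n (ESeq e5 (ESeq e6 (ESeq e7 e8))) e'.
Qed.

Lemma comp2_add : comp2 addn.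
Proof.
move=> k i j ik jk.
have cf : comp2 (fun x _ => x) by move=> ? *; apply: computable_var.
have cG : comp4 (fun _ _ _ a => a.+1).
  by move=> ? *; apply/computable_succ/computable_var.
apply: computable_ext (comp3_rec cf cG ik jk jk) _ => s /=.
by elim: (s i) => //= n ->.
Qed.

Lemma comp1_pred : comp1 predn.
Proof.
move=> k i ik.
have cf : comp2 (fun _ _ => 0) by move=> ? *; apply: computable_zero.
have cG : comp4 (fun _ _ b _ => b) by move=> ? *; apply: computable_var.
by apply: computable_ext (comp3_rec cf cG ik ik ik) _ => s /=; case: (s i).
Qed.

Lemma comp2_sub : comp2 subn.
Proof.
move=> k i j ik jk.
have cf : comp2 (fun x _ => x) by move=> ? *; apply: computable_var.
have cG : comp4 (fun _ _ _ a => a.-1).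
  by move=> ? *; apply: (computable_app1 comp1_pred); apply: computable_var.
apply: computable_ext (comp3_rec cf cG jk ik ik) _ => s /=.
by elim: (s j) => /= [|n ->]; rewrite ?subn0 // subnS.
Qed.

Lemma comp2_mul : comp2 muln.
Proof.
move=> k i j ik jk.
have cf : comp2 (fun _ _ => 0) by move=> ? *; apply: computable_zero.
have cG : comp4 (fun x _ _ a => x + a).
  by move=> ? *; apply: (computable_app2 comp2_add); apply: computable_var.
apply: computable_ext (comp3_rec cf cG ik jk jk) _ => s /=.
by elim: (s i) => //= n ->; rewrite mulSn.
Qed.

Definition ifn (c a b : nat) : nat := if c == 0 then b else a.

Lemma comp3_ifn : comp3 ifn.
Proof.
move=> k i j l ik jk lk.
have cf : comp2 (fun _ y => y) by move=> ? *; apply: computable_var.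
have cG : comp4 (fun x _ _ _ => x) by move=> ? *; apply: computable_var.
apply: computable_ext (comp3_rec cf cG ik jk lk) _ => s /=.
by rewrite /ifn; case: (s i).
Qed.

Definition eqn_nat (a b : nat) : nat := a == b.

Lemma comp2_eqn : comp2 eqn_nat.
Proof.
move=> k i j ik jk.
apply: (@computable_ext _ (fun s => 1 - ((s i - s j) + (s j - s i)))).
  apply: (computable_app2 comp2_sub); first exact: computable_const.
  apply: (computable_app2 comp2_add); apply: (computable_app2 comp2_sub);
    exact: computable_var.
by move=> s; rewrite /eqn_nat; case: eqP; lia.
Qed.

Definition leq_nat (a b : nat) : nat := a <= b.

Lemma comp2_leq : comp2 leq_nat.
Proof.
move=> k i j ik jk.
apply: (@computable_ext _ (fun s => 1 - (s i - s j))).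
  apply: (computable_app2 comp2_sub); first exact: computable_const.
  by apply: (computable_app2 comp2_sub); apply: computable_var.
by move=> s; rewrite /leq_nat; case: leqP; lia.
Qed.

Ltac compute_with tac := repeat first
  [ by apply: computable_var
  | exact: computable_const
  | apply: computable_succ
  | tac
  | apply: (computable_app2 comp2_add)
  | apply: (computable_app1 comp1_pred)
  | apply: (computable_app2 comp2_sub)
  | apply: (computable_app2 comp2_mul)
  | apply: (computable_app3 comp3_ifn)
  | apply: (computable_app2 comp2_eqn)
  | apply: (computable_app2 comp2_leq) ].

(** * Pairs and association lists of numbers *)

Definition nsqrt (n : nat) : nat :=
  iteri n (fun _ a => ifn (leq_nat (a.+1 * a.+1) n) a.+1 a) 0.

Lemma comp1_sqrt : comp1 nsqrt.
Proof.
move=> k i ik; rewrite /nsqrt.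
have cf : comp2 (fun _ _ => 0) by move=> ? *; apply: computable_zero.
have cG : comp4 (fun x _ _ a => ifn (leq_nat (a.+1 * a.+1) x) a.+1 a).
  by move=> ? *; compute_with fail.
exact: (comp3_rec cf cG ik ik ik).
Qed.

Lemma nsqrt_eq r n : r * r <= n -> n < r.+1 * r.+1 -> nsqrt n = r.
Proof.
move=> rn nr; rewrite /nsqrt; set g := fun _ a => _.
suff W m : iteri m g 0 = minn m r by rewrite W; apply/minn_idPr; nia.
elim: m => [|m IH]; first by rewrite min0n.
rewrite /= IH /g /ifn /leq_nat; have [mr|mr] : m < r \/ r <= m by lia.
  have -> : minn m r = m by lia.
  have -> : minn m.+1 r = m.+1 by lia.
  by have -> : m.+1 * m.+1 <= n by nia.
have -> : minn m r = r by lia.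
have -> : minn m.+1 r = r by lia.
by have -> : r.+1 * r.+1 <= n = false by lia.
Qed.

Lemma nsqrt_leq n : nsqrt n <= n.
Proof.
rewrite /nsqrt; set g := fun _ a => _.
suff W m : iteri m g 0 <= m by apply: W.
by elim: m => //= m; move: (iteri m g 0) => u IH; rewrite /g /ifn; case: ifP => _; lia.
Qed.

(** As [a <= a + b], the code lies between the square of [a + b] and the next square, so the integer
    square root recovers the sum. *)
Definition npair (a b : nat) : nat := (a + b) * (a + b) + a.
Definition nfst (n : nat) : nat := n - nsqrt n * nsqrt n.
Definition nsnd (n : nat) : nat := nsqrt n - nfst n.

Lemma nsqrt_pair a b : nsqrt (npair a b) = a + b.
Proof. by apply: nsqrt_eq; rewrite /npair; nia. Qed.

Lemma nfst_pair a b : nfst (npair a b) = a.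
Proof. by rewrite /nfst nsqrt_pair /npair addKn. Qed.

Lemma nsnd_pair a b : nsnd (npair a b) = b.
Proof. by rewrite /nsnd nsqrt_pair nfst_pair addKn. Qed.

Definition npairE := (nfst_pair, nsnd_pair).

Lemma npair_eq a b c d : (npair a b == npair c d) = (a == c) && (b == d).
Proof.
apply/eqP/andP => [E|[/eqP -> /eqP ->] //].
by move: (congr1 nfst E) (congr1 nsnd E); rewrite !npairE => -> ->.
Qed.

Lemma leq_pairr a b : b <= npair a b. Proof. by rewrite /npair; nia. Qed.

Lemma comp2_pair : comp2 npair.
Proof. by move=> k i j ik jk; rewrite /npair; compute_with fail. Qed.

Lemma comp1_fst : comp1 nfst.
Proof.
move=> k i ik; rewrite /nfst; compute_with ltac:(apply: (computable_app1 comp1_sqrt)).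
Qed.

Lemma comp1_snd : comp1 nsnd.
Proof.
move=> k i ik; rewrite /nsnd.
compute_with ltac:(first [apply: (computable_app1 comp1_sqrt)
  | apply: (computable_app1 comp1_fst)]).
Qed.

Ltac compute_pairs tac := compute_with ltac:(first [ tac
  | apply: (computable_app2 comp2_pair)
  | apply: (computable_app1 comp1_fst)
  | apply: (computable_app1 comp1_snd) ]).

Definition nacons (k v l : nat) : nat := (npair (npair k v) l).+1.

Definition nseek (key a : nat) : nat :=
  ifn a (ifn (eqn_nat (nfst (nfst a.-1)) key) a (nsnd a.-1)) 0.

(** The tail of a coded list is a smaller number, so [l] iterations are enough to reach the key or
    the empty list 0. *)
Definition nfind (l key : nat) : nat := iteri l (fun _ a => nseek key a) l.

(* The value of [key] in [l] plus one, or 0 if [key] is absent. *)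
Definition nget (l key : nat) : nat :=
  ifn (nfind l key) (nsnd (nfst (nfind l key).-1)).+1 0.

Lemma comp2_get : comp2 nget.
Proof.
have cF : comp2 nfind.
  move=> k i j ik jk.
  have cf : comp2 (fun _ y => y) by move=> ? *; apply: computable_var.
  have cG : comp4 (fun x _ _ a => nseek x a).
    by move=> ? *; rewrite /nseek; compute_pairs fail.
  exact: (comp3_rec cf cG ik jk ik).
move=> k i j ik jk; rewrite /nget; compute_pairs ltac:(apply: (computable_app2 cF)).
Qed.

(** [nseek key] either fixes its argument or decreases it. Hence all iteration counts at least as
    large as the argument agree, and the count for the longer list can be replaced by the one for
    [l]. *)
Lemma nfind_cons k v l key : nfind (nacons k v l) key =
  if k == key then nacons k v l else nfind l key.
Proof.
have seekE k' v' l' : nseek key (nacons k' v' l') =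
    if k' == key then nacons k' v' l' else l'.
  by rewrite /nseek /ifn /eqn_nat /= !npairE; case: (k' == key).
have iterE m a : iteri m (fun _ => nseek key) a = iter m (nseek key) a.
  by elim: m => //= m ->.
have fixE a m : nseek key a = a -> iter m (nseek key) a = a.
  by move=> E; elim: m => //= m ->.
have seek_lt a : nseek key a = a \/ nseek key a < a.
  rewrite /nseek /ifn; case: a => [|a] /=; first by left.
  case: ifP => _; last by left.
  by right; rewrite ltnS (leq_trans (leq_subr _ _)) // nsqrt_leq.
have stable m a : a <= m -> iter m (nseek key) a = iter a (nseek key) a.
  elim/ltn_ind: m a => m IH a am.
  have [E|lt] := seek_lt a; first by rewrite !fixE.
  case: m a am lt IH => [|m] [|a] // am lt IH.
  by rewrite !iterSr; transitivity (iter (nseek key a.+1) (nseek key) (nseek key a.+1));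
    [|symmetry]; apply: IH; lia.
rewrite /nfind !iterE.
have := seekE k v l; case: ifP => _ E; first exact: fixE.
rewrite -[X in iter X]prednK // iterSr E.
by apply: stable; rewrite /= leq_pairr.
Qed.

Lemma nget_cons k v l key : nget (nacons k v l) key = if k == key then v.+1 else nget l key.
Proof.
by rewrite /nget nfind_cons; case: eqP => // _; rewrite /ifn /= !npairE.
Qed.

(** * Machines whose control is a number *)

(* [f] runs through the values of [g] with delays, in both directions cofinally;
   this preserves the supremum and the limsup over the natural numbers. *)
Definition tracks (f g : nat -> bool) : Prop :=
  [/\ forall m, exists k, f m = g k,
      forall K, exists N, forall m, N <= m -> exists2 k, K <= k & f m = g k &
      forall k, exists2 m, k <= m & f m = g k].

Lemma tracks_trans f g h : tracks f g -> tracks g h -> tracks f h.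
Proof.
move=> [f1 f2 f3] [g1 g2 g3]; split.
- by move=> m; have [k ->] := f1 m; apply: g1.
- move=> K; have [N gN] := g2 K; have [N' fN] := f2 N; exists N' => m /fN [k Nk ->].
  exact: gN.
- move=> k; have [m km <-] := g3 k; have [m' mm <-] := f3 m; exists m' => //; lia.
Qed.

Lemma tracks_sup f g : tracks f g -> (exists m, f m) -> exists k, g k.
Proof. by case=> f1 _ _ [m fm]; have [k E] := f1 m; exists k; rewrite -E. Qed.

Lemma tracks_sup_inv f g : tracks f g -> (exists k, g k) -> exists m, f m.
Proof. by case=> _ _ f3 [m fm]; have [k _ E] := f3 m; exists k; rewrite E. Qed.

Lemma tracks_limsup f g : tracks f g -> (forall N, exists2 m, N <= m & f m) ->
  forall N, exists2 k, N <= k & g k.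
Proof.
case=> _ f2 _ fc K; have [N fN] := f2 K; have [m Nm fm] := fc N.
by have [k Kk E] := fN m Nm; exists k => //; rewrite -E.
Qed.

Lemma tracks_limsup_inv f g : tracks f g -> (forall N, exists2 m, N <= m & g m) ->
  forall N, exists2 k, N <= k & f k.
Proof.
case=> _ _ f3 gc K; have [m Km gm] := gc K; have [k mk E] := f3 m.
by exists k; [lia|rewrite E].
Qed.

Definition scode (s : symbols) : nat := npair (bit 0 s) (npair (bit 1 s) (bit 2 s)).

Lemma scode_inj : injective scode.
Proof.
move=> [[a b] c] [[a' b'] c'] /eqP; rewrite /scode !npair_eq /=.
by case: a a' b b' c c' => [] [] [] [] [] [].
Qed.

(** A symbol is written one bit at a time, so an intermediate array may be neither the old nor the
    new one. Each single bit is old or new, and the limsup only looks at single bits. *)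
Definition between (X X' Y : tape) : Prop := forall n j,
  bit j (Y n) = bit j (X n) \/ bit j (Y n) = bit j (X' n).

Section NumericControl.
Variables (P : nat -> nat) (F : nat -> nat -> nat) (W : nat -> nat -> nat -> nat).
Hypotheses (cP : comp1 P) (cF : comp2 F) (cW : forall j, comp2 (W j)).

Definition written (n a : nat) : symbols :=
  (W 0 n a != 0, W 1 n a != 0, W 2 n a != 0).

Definition macro_step (c : nat * tape) : nat * tape :=
  let: (n, X) := c in let a := scode (X (P n)) in
  (F n a, fput X (P n) (written n a)).

Lemma exec_computable k f r : computable k f -> k <= r ->
  exists c, computes c r f.
Proof. by move=> cf kr; apply: cf.2. Qed.

Definition read_bit (j x y : nat) : cmd :=
  Seq (While y (Dec y)) (IfBit j x (Inc y) Skip).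

Lemma exec_read_bit (I : tape -> Prop) j x y s (X : tape) : x != y -> I X ->
  exec I (read_bit j x y) (s, X) (fput s y (bit j (X (s x)) : nat), X).
Proof.
move=> xy IX; apply: ESeq (exec_zero IX _ _) _.
apply: EIfBit => //; rewrite fput_other //.
case: (bit j _); last exact: ESkip.
by have := EInc y (fput s y 0) IX; rewrite fput_same fput_fput.
Qed.

Definition write_bit (j x y : nat) : cmd :=
  IfReg y (Write j x true) (Write j x false).

Lemma exec_write_bit (I : tape -> Prop) j x y s (X : tape) : I X ->
  I (fput X (s x) (set_bit j (s y != 0) (X (s x)))) ->
  exec I (write_bit j x y) (s, X) (s, fput X (s x) (set_bit j (s y != 0) (X (s x)))).
Proof. by move=> IX; case E: (s y != 0) => IX'; apply: EIfReg => //; rewrite E; apply: EWrite. Qed.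

Lemma exec_macro_step : exists c, forall s X, exists s',
  exec (between X (macro_step (s 0, X)).2) c (s, X) (s', (macro_step (s 0, X)).2) /\
  s' 0 = (macro_step (s 0, X)).1.
Proof.
have [c1 e1] := exec_computable (@cP 1 0 isT) (leqnn 1).
have [c5 e5] : exists c, computes c 5 (fun s => npair (s 2) (npair (s 3) (s 4))).
  by apply: (@exec_computable 5) => //; compute_pairs fail.
have [c6 e6] := exec_computable (@cW 0 6 0 5 isT isT) (leqnn 6).
have [c7 e7] := exec_computable (@cW 1 6 0 5 isT isT) (leqnSn 6).
have [c8 e8] := exec_computable (@cW 2 6 0 5 isT isT) (isT : 6 <= 8).
have [c9 e9] := exec_computable (@cF 6 0 5 isT isT) (isT : 6 <= 9).
(* Register 0 holds the control number, 1 the position, 2 to 4 the bits read, 5 their code, 6 to 8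
   the bits to write, 9 the next control number. *)
exists (Seq c1 (Seq (read_bit 0 1 2) (Seq (read_bit 1 1 3) (Seq (read_bit 2 1 4)
  (Seq c5 (Seq c6 (Seq c7 (Seq c8 (Seq c9 (Seq (write_bit 0 1 6)
  (Seq (write_bit 1 1 7) (Seq (write_bit 2 1 8) (move_reg 9 0))))))))))))) => s X.
set X' := (macro_step _).2; set I := between X X'.
have IX : I X by move=> n j; left.
have [s1 [E1 v1 z1]] := e1 I s X IX.
have E2 := @exec_read_bit I 0 1 2 s1 X isT IX; set s2 := fput s1 _ _ in E2.
have E3 := @exec_read_bit I 1 1 3 s2 X isT IX; set s3 := fput s2 _ _ in E3.
have E4 := @exec_read_bit I 2 1 4 s3 X isT IX; set s4 := fput s3 _ _ in E4.
have [s5 [E5 v5 z5]] := e5 I s4 X IX.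
have [s6 [E6 v6 z6]] := e6 I s5 X IX.
have [s7 [E7 v7 z7]] := e7 I s6 X IX.
have [s8 [E8 v8 z8]] := e8 I s7 X IX.
have [s9 [E9 v9 z9]] := e9 I s8 X IX.
set n := s 0; set p := P n; set a := scode (X p).
have w41 : s4 1 = p by rewrite /s4 /s3 /s2 /fput /= v1.
have w40 : s4 0 = n by rewrite /s4 /s3 /s2 /fput /= z1.
have w55 : s5 5 = a.
  by rewrite v5 /s4 /s3 /s2 /fput /= v1.
have w80 : s8 0 = n by rewrite z8 // z7 // z6 // z5.
have w70 : s7 0 = n by rewrite z7 // z6 // z5.
have w60 : s6 0 = n by rewrite z6 // z5.
have w50 : s5 0 = n by rewrite z5.
have w65 : s6 5 = a by rewrite z6.
have w75 : s7 5 = a by rewrite z7.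
have w85 : s8 5 = a by rewrite z8.
have w91 : s9 1 = p by rewrite z9 // z8 // z7 // z6 // z5.
have w96 : s9 6 = W 0 n a by rewrite z9 // z8 // z7 // v6 w50 w55.
have w97 : s9 7 = W 1 n a by rewrite z9 // z8 // v7 w60 w65.
have w98 : s9 8 = W 2 n a by rewrite z9 // v8 w70 w75.
have w99 : s9 9 = F n a by rewrite v9 w80 w85.
have X'E : X' = fput X p (written n a) by [].
have E10 := @exec_write_bit I 0 1 6 s9 X IX; rewrite w91 w96 in E10.
set X1 := fput X _ _ in E10.
have IX1 : I X1.
  move=> m j; rewrite X'E /X1 /fput; case: eqP => [->|]; last by left.
  by case: j => [|[|j]]; [right|left|left].
have E11 := @exec_write_bit I 1 1 7 s9 X1 IX1; rewrite w91 w97 in E11.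
set X2 := fput X1 _ _ in E11.
have IX2 : I X2.
  move=> m j; rewrite X'E /X2 /X1 /fput eqxx; case: eqP => [->|]; last by left.
  by case: j => [|[|j]]; [right|right|left].
have E12 := @exec_write_bit I 2 1 8 s9 X2 IX2; rewrite w91 w98 in E12.
set X3 := fput X2 _ _ in E12.
have X3E : X3 = X'.
  by rewrite X'E /X3 /X2 /X1; apply/funext => m; rewrite /fput eqxx; case: eqP.
have IX' : I X' by move=> m j; right.
rewrite X3E in E12.
have E13 := @exec_move I X' IX' 9 0 s9 isT.
exists (fput (fput s9 0 (s9 9)) 9 0); split; last by rewrite fput_other // fput_same w99.
apply: ESeq E1 (ESeq E2 (ESeq E3 (ESeq E4 (ESeq E5 (ESeq E6 (ESeq E7 (ESeq E8
  (ESeq E9 (ESeq (E10 IX1) (ESeq (E11 IX2) (ESeq (E12 IX') E13))))))))))).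
Qed.

(** The kinds of stages at which a block begins: [None] is stage zero, [Some true] an uncountable
    cardinal, [Some false] any other limit. *)
Definition kind : Type := option bool.
Variable n0 : kind -> nat.

Lemma exec_const n : exists c, forall I s (X : tape), I X -> exists s',
  exec I c (s, X) (s', X) /\ s' 0 = n.
Proof.
have [c e] := exec_computable (computable_const 0 n) (leqnn 0).
by exists c => I s X IX; have [s' [E v _]] := e I s X IX; exists s'.
Qed.

(** * The simulating machine and its behaviour during one block *)

Section Program.
Variables (K : nat) (body : cmd) (start : kind -> cmd).
Hypotheses (K_gt0 : 0 < K) (bodyK : regs_below K body).
Hypothesis startK : forall k, regs_below K (start k).
Hypothesis bodyE : forall s X, exists s',
  exec (between X (macro_step (s 0, X)).2) body (s, X) (s', (macro_step (s 0, X)).2) /\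
  s' 0 = (macro_step (s 0, X)).1.
Hypothesis startE : forall k I s (X : tape), I X -> exists s',
  exec I (start k) (s, X) (s', X) /\ s' 0 = n0 k.

Definition main_cmd (k : kind) : tcmd :=
  TSeq (tinit K) (TSeq (compile K (start k)) (TWhile predT (compile K body))).

Definition main_state : finType := {k : kind & tstate (main_cmd k)}.

Definition embed_state (k : kind) (q : tstate (main_cmd k)) : state #|main_state| :=
  q_other (enum_rank (Tagged (fun k => tstate (main_cmd k)) q : main_state)).

Definition block_start (k : kind) (s : symbols) :
    state #|main_state| * symbols * direction :=
  (embed_state (tentry (main_cmd k)), s, go_left).

(** A block begins with the head on cell 0, which is array cell 0, so the limit state reads the flag
    directly; moving left keeps the head there. The exit of the ever-looping main command has the
    default [q_start], which keeps its transitions out of the halting and limit states. *)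
Definition simulator_trans (q : state #|main_state|) (s : symbols) :
    state #|main_state| * symbols * direction :=
  match q with
  | q_start => block_start None s
  | q_halt => (q_halt, s, go_left)
  | q_limit => if bit 0 s then (q_halt, s, go_left) else block_start (Some false) s
  | q_cardinal => block_start (Some true) s
  | q_other i =>
      let x : main_state := enum_val i in
      let: (o, s', d) := tdelta (tagged x) s in
      (oapp (@embed_state (tag x)) q_start o, s', d)
  end.

Definition simulator : program := Program simulator_trans.

Definition kind_state (n : nat) (k : kind) : state n :=
  match k with
  | None => q_start | Some false => q_limit | Some true => q_cardinal
  end.

Lemma simulator_embeds k :
  @embeds _ simulator_trans (main_cmd k) (@embed_state k) q_start.
Proof.
move=> q s; rewrite {1}/embed_state /= enum_rankK /=.
by case: (tdelta q s) => [[o s'] d].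
Qed.

Lemma simulator_halt q s : (simulator_trans q s).1.1 = q_halt ->
  q = q_halt \/ (q = q_limit /\ bit 0 s).
Proof.
case: q => [||||i]; rewrite /simulator_trans //.
- by left.
- by case: ifP => // H _; right.
set x := (enum_val i : main_state).
by move: (tdelta (tagged x) s) => [[[o|] s'] d].
Qed.

Lemma simulator_not_limit q s : (simulator_trans q s).1.1 <> q_limit.
Proof.
case: q => [||||i]; rewrite /simulator_trans //; first by case: ifP.
set x := (enum_val i : main_state).
by move: (tdelta (tagged x) s) => [[[o|] s'] d].
Qed.

Section Block.
Variables (k : kind) (t : tape) (t_clean : clean K t).
Hypothesis no_halt : k = Some false -> bit 0 (t 0) = false.

Let c (m : nat) := iter m (tm_step simulator_trans) (kind_state _ k, 0, t).
Let Z (i : nat) := iter i macro_step (n0 k, array_of K t).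

Let loop_entry : state #|main_state| :=
  embed_state (inr (inr (inl None)) : tstate (main_cmd k)).

Let good (i : nat) (x : state #|main_state| * nat * tape) :=
  exists t' r, [/\ x = (loop_entry, 0, t'), represents K r (Z i).2 t' & r 0 = (Z i).1].

Lemma block_first_step : c 1 = (embed_state (tentry (main_cmd k)), 0, t).
Proof.
rewrite /c /= /tm_step; case: k no_halt => [[]|] //= H; rewrite ?fput_id //.
by rewrite (H erefl) /= fput_id.
Qed.

Lemma block_prologue : exists2 m0, good 0 (c m0) &
  forall m, m <= m0 -> safe K (eq (array_of K t)) (c m).2.
Proof.
have Jt : safe K (eq (array_of K t)) t by [].
have E := @simulator_embeds k.
have [E1 E2] := embeds_seq E; have [E3 E4] := embeds_seq E2.
have [t1 [R1 X1]] := texec_init K_gt0 Jt.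
have [s2 [X2 s20]] := @startE k (eq (array_of K t)) (fun=> 0) (array_of K t) erefl.
have [_ [t2 [R2 X2']]] := texec_compile K_gt0 X2 (startK k) R1.
have := reach_trans (texec_reach X1 E1) (texec_reach X2' E3).
case=> n [nE nJ]; exists n.+2.
  by exists t2, s2; split=> //; rewrite /c -addn1 iterD -[iter 1 _ _]/(c 1) block_first_step nE.
move=> [|[|m]] mn //; first by rewrite block_first_step.
by rewrite /c -addn1 iterD -[iter 1 _ _]/(c 1) block_first_step; apply: nJ; lia.
Qed.

Lemma block_round i x : good i x -> exists n, [/\ 0 < n,
  good i.+1 (iter n (tm_step simulator_trans) x) &
  forall m, m <= n -> safe K (between (Z i).2 (Z i.+1).2)
    (iter m (tm_step simulator_trans) x).2].
Proof.
move=> [t' [r [-> R r0]]].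
have E := @simulator_embeds k.
have [E1 E2] := embeds_seq E; have [E3 E4] := embeds_seq E2.
have [s' [X1 s'0]] := bodyE r (Z i).2.
have ZE : macro_step (r 0, (Z i).2) = Z i.+1 by rewrite r0 -surjective_pairing.
rewrite ZE in X1 s'0.
have IX : between (Z i).2 (Z i.+1).2 (Z i).2 by move=> n j; left.
have [_ [t2 [R2 X2]]] := texec_compile K_gt0 X1 bodyK R.
have Jt := represents_safe R IX.
have /= := reach_trans (reach_while 0 E4 Jt) (texec_reach X2 (embeds_while E4)).
case=> n [nE nJ]; exists n.+1; split=> //.
  by rewrite nE; exists t2, s'.
by move=> [|m] mn //; apply: nJ.
Qed.

(** [tau i] is a time at which the machine stands at the loop entry with [i] macro steps
    completed. *)
Lemma block_schedule : exists tau : nat -> nat,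
  (forall m, m <= tau 0 -> safe K (eq (array_of K t)) (c m).2) /\
  forall i, [/\ good i (c (tau i)), tau i < tau i.+1 &
    forall m, tau i <= m <= tau i.+1 -> safe K (between (Z i).2 (Z i.+1).2) (c m).2].
Proof.
have [m0 g0 J0] := block_prologue.
(* A next time is chosen for every pair of an index and a time; it is a dummy 0 when the machine is
   not at the loop entry, and the recursion never meets that case. *)
have ex (im : nat * nat) : exists m', good im.1 (c im.2) -> [/\ good im.1.+1 (c m'),
    im.2 < m' & forall m, im.2 <= m <= m' -> safe K (between (Z im.1).2 (Z im.1.+1).2) (c m).2].
  case: im => i m1 /=; have [g1|ng1] := pselect (good i (c m1)); last by exists 0.
  have [n [n0' gn Jn]] := block_round g1; exists (n + m1) => _; split.
  - by rewrite /c iterD.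
  - by lia.
  - move=> m mm; have -> : m = (m - m1) + m1 by lia.
    by rewrite /c iterD; apply: Jn; lia.
have [nxt nxtP] := choice ex.
exists (fun i => iteri i (fun i m => nxt (i, m)) m0); split=> // i.
have gi : good i (c (iteri i (fun i m => nxt (i, m)) m0)).
  by elim: i => // i IH; have [] := nxtP (i, _) IH.
by have [? ? ?] := nxtP (i, _) gi; split.
Qed.

Lemma block_clean m : clean K (c m).2.
Proof.
have [tau [J0 JS]] := block_schedule.
have tau_ge i : i <= tau i by elim: i => // i IH; have [_ lt _] := JS i; lia.
have upto i : m <= tau i -> clean K (c m).2.
  elim: i => [/J0 [] //|i IH] mi; case: (leqP m (tau i)) => [/IH //|im].
  by have [_ _ /(_ m)] := JS i; case=> //; rewrite (ltnW im).
exact: upto (tau_ge m).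
Qed.

Lemma block_tracks p j :
  tracks (fun m => bit j ((c m).2 (K.+1 * p))) (fun i => bit j ((Z i).2 p)).
Proof.
have [tau [J0 JS]] := block_schedule.
have tau_ge i : i <= tau i by elim: i => // i IH; have [_ lt _] := JS i; lia.
have find I m : tau I <= m -> exists2 i, I <= i & tau i <= m < tau i.+1.
  elim: m => [|m IH] Im.
    by exists I => //; have [_ lt _] := JS I; lia.
  case: (ltngtP (tau I) m.+1) Im => // [Im|E] _.
    have [i Ii im] := IH Im; have [_ lt _] := JS i.+1.
    by case: (ltnP m.+1 (tau i.+1)) => im'; [exists i|exists i.+1]; lia.
  by exists I => //; have [_ lt _] := JS I; lia.
have mid I m : tau I <= m -> exists2 i, I <= i &
    bit j ((c m).2 (K.+1 * p)) = bit j ((Z i).2 p).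
  move=> /find [i Ii im]; have [_ _ /(_ m) [|_ H]] := JS i; first by lia.
  by case: (H p j) => E; [exists i|exists i.+1 => //; lia].
split.
- move=> m; case: (leqP (tau 0) m) => [/mid [i _ E]|/ltnW/J0 [_ E]]; first by exists i.
  by exists 0; rewrite /Z /= E.
- by move=> I; exists (tau I) => m; apply: mid.
- move=> i; exists (tau i) => //; have [[t' [r [-> [E _ _ _] _]]] _ _] := JS i.
  by rewrite /= -E.
Qed.
End Block.
End Program.

(** These four facts are all that is used of the compiled machine from here on. One [K] bounds the
    registers of the macro step and of the three initialisations. *)
Lemma numeric_control : exists (M : program) (K : nat),
  [/\ forall q s, (@trans M q s).1.1 = q_halt -> q = q_halt \/ q = q_limit /\ bit 0 s,
      forall q s, (@trans M q s).1.1 <> q_limit,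
      forall s, bit 0 s -> (@trans M q_limit s).1.1 = q_halt &
      forall k t, clean K t -> (k = Some false -> bit 0 (t 0) = false) ->
        let c m := iter m (tm_step (@trans M)) (kind_state _ k, 0, t) in
        (forall m, clean K (c m).2) /\
        forall p j, tracks (fun m => bit j ((c m).2 (K.+1 * p)))
          (fun i => bit j ((iter i macro_step (n0 k, array_of K t)).2 p))].
Proof.
have [body bodyE] := exec_macro_step.
have [start startE] := choice (fun k => exec_const (n0 k)).
have [K0 bK0] := regs_below_ex body.
have [K1 sK1] := regs_below_ex (start None).
have [K2 sK2] := regs_below_ex (start (Some false)).
have [K3 sK3] := regs_below_ex (start (Some true)).
pose K := (K0 + K1 + K2 + K3).+1.
have bK : regs_below K body by apply: regs_below_mono bK0; lia.
have sK k : regs_below K (start k).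
  by case: k => [[]|]; [apply: regs_below_mono sK3|apply: regs_below_mono sK2
    |apply: regs_below_mono sK1]; lia.
exists (simulator K body start), K; split.
- exact: simulator_halt.
- exact: simulator_not_limit.
- by move=> s /= ->.
- move=> k t ct nh c; split=> [m|p j].
    exact: (block_clean (isT : 0 < K) bK sK bodyE (fun k => @startE k)).
  exact: (block_tracks (isT : 0 < K) bK sK bodyE (fun k => @startE k)).
Qed.
End NumericControl.

(** * Dovetailing all machines *)

(** A missing key yields 0, so every number is the table of some machine and the dovetailing can
    range over all numbers. *)
Definition table_entry (i q : nat) (s : symbols) : nat := (nget i (npair q (scode s))).-1.

(* The machine whose table is the association list [i].  States are coded by
   numbers, 1 being the halting state; cell 0 of the tape holds a flag that
   records whether the halting state was ever entered, and the cells of the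
   simulated machine are shifted by one. *)
Definition nstep (i : nat) (c : nat * nat * tape) : nat * nat * tape :=
  let: (q, h, T) := c in
  let v := table_entry i q (T h.+1) in
  let w := (nfst (nsnd v) != 0, nfst (nsnd (nsnd v)) != 0,
            nfst (nsnd (nsnd (nsnd v))) != 0) in
  (nfst v, if nsnd (nsnd (nsnd (nsnd v))) == 0 then h.-1 else h.+1,
   fput (fput T h.+1 w) 0 (set_bit 0 ((nfst v == 1) || bit 0 (T 0)) (T 0))).

(** A first halt: the halting state is entered while the flag of the machine is still down. *)
Definition nhalts (i : nat) (c : nat * nat * tape) : bool :=
  ((nstep i c).1.1 == 1) && ~~ bit 0 (c.2 0).

(* The number controlling the simulator: phase, round, association list of the
   states and heads of the machines started so far, event, initial state. *)
Definition ctl (ph k l e kd : nat) : nat :=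
  npair ph (npair k (npair l (npair e kd))).

Definition ctl_round (n : nat) : nat := nfst (nsnd n).
Definition ctl_list (n : nat) : nat := nfst (nsnd (nsnd n)).
Definition ctl_event (n : nat) : nat := nfst (nsnd (nsnd (nsnd n))).
Definition ctl_init (n : nat) : nat := nsnd (nsnd (nsnd (nsnd n))).

(** A machine absent from the list has not moved in this block, so it is in the initial state [kd]
    with its head on cell 0. *)
Definition lookup (i l kd : nat) : nat := ifn (nget l i) (nget l i).-1 (npair kd 0).

Definition ctl_index (n : nat) : nat := nfst (ctl_round n).
Definition ctl_current (n : nat) : nat := lookup (ctl_index n) (ctl_list n) (ctl_init n).
Definition ctl_entry (n a : nat) : nat :=
  (nget (ctl_index n) (npair (nfst (ctl_current n)) a)).-1.

(** Round [k] makes one step of machine [nfst k], so each machine gets infinitely many rounds. Phase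
    0 writes the cell under its head, phase 1 its halting flag, phase 2 the simulator's own flag in
    array cell 0. Cell [m] of machine [i] is array cell [(npair i m).+1]. *)
Definition ctl_pos (n : nat) : nat :=
  ifn (nfst n)
    (ifn (eqn_nat (nfst n) 1) (npair (ctl_index n) 0).+1 0)
    (npair (ctl_index n) (nsnd (ctl_current n)).+1).+1.

Definition ctl_flag (n a : nat) : nat :=
  ifn (eqn_nat (nfst n) 1)
    (ifn (ctl_event n) 1 (nfst a))
    (ifn (eqn_nat (ctl_event n) 1) 0 (ifn (ctl_event n) 1 (nfst a))).

Definition ctl_write (j n a : nat) : nat :=
  match j with
  | 0 => ifn (nfst n) (ctl_flag n a) (nfst (nsnd (ctl_entry n a)))
  | 1 => ifn (nfst n) (nfst (nsnd a)) (nfst (nsnd (nsnd (ctl_entry n a))))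
  | _ => ifn (nfst n) (nsnd (nsnd a)) (nfst (nsnd (nsnd (nsnd (ctl_entry n a)))))
  end.

(** From phase 1 to phase 2 a halting event is kept only if the machine's flag was still down, so
    later visits to the halting state do not lower the simulator's flag. *)
Definition ctl_next (n a : nat) : nat :=
  ifn (nfst n)
    (ifn (eqn_nat (nfst n) 1)
       (ctl 2 (ctl_round n) (ctl_list n) (ifn (ctl_event n) (1 - nfst a) 0) (ctl_init n))
       (ctl 0 (ctl_round n).+1 (ctl_list n) 0 (ctl_init n)))
    (ctl 1 (ctl_round n)
       (nacons (ctl_index n)
          (npair (nfst (ctl_entry n a))
             (ifn (nsnd (nsnd (nsnd (nsnd (ctl_entry n a)))))
                (nsnd (ctl_current n)).+1 (nsnd (ctl_current n)).-1))
          (ctl_list n))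
       (eqn_nat (nfst (ctl_entry n a)) 1) (ctl_init n)).

(** The numbers of the start, limit and cardinal states; 1 is taken by the halting state. *)
Definition kind_code (k : kind) : nat :=
  match k with None => 0 | Some false => 2 | Some true => 3 end.

(* The event 2 makes the first macro step raise the flag in array cell 0. *)
Definition ctl_start (k : kind) : nat :=
  ctl 2 0 0 (if k is Some true then 2 else 0) (kind_code k).

Lemma comp1_current : comp1 ctl_current.
Proof.
move=> k i ik; rewrite /ctl_current /lookup /ctl_index /ctl_list /ctl_init /ctl_round.
compute_pairs ltac:(apply: (computable_app2 comp2_get)).
Qed.

Lemma comp2_entry : comp2 ctl_entry.
Proof.
move=> k i j ik jk; rewrite /ctl_entry /ctl_index /ctl_round.
compute_pairs ltac:(first [apply: (computable_app1 comp1_current)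
 | apply: (computable_app2 comp2_get)]).
Qed.

Ltac compute_ctl := compute_pairs ltac:(first [
   apply: (computable_app1 comp1_current) | apply: (computable_app2 comp2_entry)]).

Lemma comp1_pos : comp1 ctl_pos.
Proof. by move=> k i ik; rewrite /ctl_pos /ctl_index /ctl_round; compute_ctl. Qed.

Lemma comp2_write j : comp2 (ctl_write j).
Proof.
move=> k x y xk yk; rewrite /ctl_write /ctl_flag /ctl_event.
by case: j => [|[|j]]; compute_ctl.
Qed.

Lemma comp2_next : comp2 ctl_next.
Proof.
move=> k i j ik jk.
rewrite /ctl_next /ctl /nacons /ctl_index /ctl_round /ctl_list /ctl_init /ctl_event.
compute_ctl.
Qed.

Definition dovetail : nat * tape -> nat * tape :=
  macro_step ctl_pos ctl_next ctl_write.

Section Ctl.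
Variables ph k l e kd : nat.
Lemma ctl_phaseE : nfst (ctl ph k l e kd) = ph. Proof. by rewrite /ctl !npairE. Qed.
Lemma ctl_roundE : ctl_round (ctl ph k l e kd) = k.
Proof. by rewrite /ctl /ctl_round !npairE. Qed.
Lemma ctl_listE : ctl_list (ctl ph k l e kd) = l.
Proof. by rewrite /ctl /ctl_list !npairE. Qed.
Lemma ctl_eventE : ctl_event (ctl ph k l e kd) = e.
Proof. by rewrite /ctl /ctl_event !npairE. Qed.
Lemma ctl_initE : ctl_init (ctl ph k l e kd) = kd.
Proof. by rewrite /ctl /ctl_init !npairE. Qed.
End Ctl.
Definition ctlE := (ctl_phaseE, ctl_roundE, ctl_listE, ctl_eventE, ctl_initE).

Definition region (X : tape) (i : nat) : tape := fun m => X (npair i m).+1.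

Lemma scode_bits s : [/\ nfst (scode s) = bit 0 s,
  nfst (nsnd (scode s)) = bit 1 s & nsnd (nsnd (scode s)) = bit 2 s].
Proof. by rewrite /scode !npairE. Qed.

Section Round.
Variables (k l e kd : nat) (X : tape).
Let i := nfst k.
Variables q h : nat.
Hypothesis cur : lookup i l kd = npair q h.
Let T := region X i.
Let c' := nstep i (q, h, T).
Let l' := nacons i (npair c'.1.1 c'.1.2) l.
Let X1 := fput X (npair i h.+1).+1 (c'.2 h.+1).
Let X2 := fput X1 (npair i 0).+1 (c'.2 0).
Let halt := nhalts i (q, h, T).
Let X3 := fput X2 0 (set_bit 0 (~~ halt && bit 0 (X 0)) (X 0)).

Lemma dovetail_phase0 : dovetail (ctl 0 k l e kd, X) = (ctl 1 k l' (c'.1.1 == 1) kd, X1).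
Proof.
have pE : ctl_pos (ctl 0 k l e kd) = (npair i h.+1).+1.
  by rewrite /ctl_pos /ctl_current /ctl_index !ctlE -/i cur npairE.
have vE : ctl_entry (ctl 0 k l e kd) (scode (X (npair i h.+1).+1)) =
    table_entry i q (T h.+1).
  by rewrite /ctl_entry /ctl_current /ctl_index !ctlE -/i cur npairE.
rewrite /dovetail /macro_step pE; congr pair.
  rewrite /ctl_next vE /ctl_current /ctl_index !ctlE -/i cur !npairE {1}/ifn /=.
  by rewrite /l' /c' /= /ifn.
by rewrite /X1; congr fput; rewrite /written /ctl_write vE !ctlE /ifn /= /fput /= eqxx.
Qed.

Lemma dovetail_phase1 : dovetail (ctl 1 k l' (c'.1.1 == 1) kd, X1) =
  (ctl 2 k l' halt kd, X2).
Proof.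
have pE : ctl_pos (ctl 1 k l' (c'.1.1 == 1) kd) = (npair i 0).+1.
  by rewrite /ctl_pos /ctl_index !ctlE /ifn /eqn_nat /=.
have X1E : X1 (npair i 0).+1 = T 0.
  by rewrite /X1 fput_other // eqSS npair_eq andbF.
have [b0 b1 b2] := scode_bits (T 0).
rewrite /dovetail /macro_step pE X1E; congr pair.
  rewrite /ctl_next !ctlE {1 2}/ifn /eqn_nat /= b0.
  by rewrite /halt /nhalts -/c' /ifn; case: (_ == 1); case: (bit 0 (T 0)).
rewrite /X2; congr fput.
rewrite /written /ctl_write !ctlE /ctl_flag !ctlE b0 b1 b2 /ifn /eqn_nat /=.
by rewrite /fput /=; case: (_ == 1); case: (T 0) => [[[] []] []].
Qed.

Lemma dovetail_phase2 : dovetail (ctl 2 k l' halt kd, X2) = (ctl 0 k.+1 l' 0 kd, X3).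
Proof.
have pE : ctl_pos (ctl 2 k l' halt kd) = 0.
  by rewrite /ctl_pos /ctl_index !ctlE /ifn /eqn_nat /=.
have X2E : X2 0 = X 0 by [].
have [b0 b1 b2] := scode_bits (X 0).
rewrite /dovetail /macro_step pE X2E; congr pair.
  by rewrite /ctl_next !ctlE {1 2}/ifn /eqn_nat /=.
rewrite /X3; congr fput.
rewrite /written /ctl_write !ctlE /ctl_flag !ctlE b0 b1 b2 /ifn /eqn_nat /=.
by case: halt; case: (X 0) => [[[] []] []].
Qed.
End Round.

Lemma region_fput X i m s i' :
  region (fput X (npair i m).+1 s) i' =
  if i' == i then fput (region X i') m s else region X i'.
Proof.
apply/funext => m'; rewrite /region /fput eqSS npair_eq.
by case: eqP.
Qed.

Lemma region_fput0 X s i : region (fput X 0 s) i = region X i.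
Proof. by apply/funext => m. Qed.

Lemma nstep_tape i c (c' := nstep i c) :
  c'.2 = fput (fput c.2 c.1.2.+1 (c'.2 c.1.2.+1)) 0 (c'.2 0).
Proof.
rewrite {}/c'; case: c => [[q h] T] /=; apply/funext => -[|m] //.
by rewrite /fput /= eqxx; case: eqP.
Qed.

(** * One block of the dovetailing compared with all machines *)

Section Dovetail.
Variables (k : kind) (X0 : tape).
Let kd := kind_code k.

Definition ctl_run (u : nat) : nat * tape := iter u dovetail (ctl_start k, X0).

Definition sim (i s : nat) : nat * nat * tape :=
  iter s (nstep i) (kd, 0, region X0 i).

(* The number of steps made by machine [i] before round [r.+1]. *)
Fixpoint sim_time (i r : nat) : nat :=
  if r is r'.+1 then sim_time i r' + (nfst r == i) else 0.

(** The extra macro step is phase 2 of round 0, which only sets the flag. The round begun at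
    [round_start r] therefore has number [r.+1]. *)
Definition round_start (r : nat) : nat := (3 * r).+1.

Lemma round_startS r : round_start r.+1 = (round_start r).+3.
Proof. by rewrite /round_start; lia. Qed.

Definition first_flag : bool := (if k is Some true then true else bit 0 (X0 0)).

Lemma ctl_run1 : ctl_run 1 =
  (ctl 0 1 0 0 kd, fput X0 0 (set_bit 0 first_flag (X0 0))).
Proof.
have pE e : ctl_pos (ctl 2 0 0 e kd) = 0.
  by rewrite /ctl_pos /ctl_index !ctlE /ifn /eqn_nat /=.
have [b0 b1 b2] := scode_bits (X0 0).
rewrite /ctl_run /= /ctl_start -/kd /dovetail /macro_step pE; congr pair.
  by rewrite /ctl_next !ctlE {1 2}/ifn /eqn_nat /=.
congr fput; rewrite /written /ctl_write !ctlE /ctl_flag !ctlE b0 b1 b2 /ifn /eqn_nat /=.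
by rewrite /first_flag; case: k => [[]|] /=; case: (X0 0) => [[[] []] []].
Qed.

Definition round_inv (r : nat) : Prop := exists l,
  (ctl_run (round_start r)).1 = ctl 0 r.+1 l 0 kd /\ forall i,
  lookup i l kd = npair (sim i (sim_time i r)).1.1 (sim i (sim_time i r)).1.2 /\
  region (ctl_run (round_start r)).2 i = (sim i (sim_time i r)).2.

Definition round_out (r : nat) : Prop :=
  let i0 := nfst r.+1 in
  let c := sim i0 (sim_time i0 r) in
  (forall u i m, round_start r <= u <= round_start r.+1 ->
     region (ctl_run u).2 i m = (sim i (sim_time i r)).2 m \/
     region (ctl_run u).2 i m = (sim i (sim_time i r.+1)).2 m) /\
  (forall u, round_start r <= u < round_start r.+1 ->
     bit 0 ((ctl_run u).2 0) = bit 0 ((ctl_run (round_start r)).2 0)) /\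
  bit 0 ((ctl_run (round_start r.+1)).2 0) =
    ~~ nhalts i0 c && bit 0 ((ctl_run (round_start r)).2 0).

Lemma lookup_cons i v l i' : lookup i' (nacons i v l) kd =
  if i == i' then v else lookup i' l kd.
Proof. by rewrite /lookup nget_cons; case: eqP. Qed.

Lemma round_step r : round_inv r -> round_out r /\ round_inv r.+1.
Proof.
case=> l [lE H].
set i0 := nfst r.+1; have [curE regE] := H i0.
set c := sim i0 (sim_time i0 r) in curE regE.
set X := (ctl_run (round_start r)).2 in H regE.
have z0 : ctl_run (round_start r) = (ctl 0 r.+1 l 0 kd, X).
  by rewrite [LHS]surjective_pairing lE.
have cE : c = (c.1.1, c.1.2, region X i0) by rewrite regE; case: (c) => [[]].
have simS : sim i0 (sim_time i0 r.+1) = nstep i0 c.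
  by rewrite /= eqxx addn1.
have simO i : i != i0 -> sim_time i r.+1 = sim_time i r.
  by move=> ii; rewrite /= eq_sym (negbTE ii) addn0.
have z1 : ctl_run (round_start r).+1 = dovetail (ctl_run (round_start r)) by [].
rewrite z0 (dovetail_phase0 _ X curE) in z1.
have z2 : ctl_run (round_start r).+2 = dovetail (ctl_run (round_start r).+1) by [].
rewrite z1 dovetail_phase1 in z2.
have z3 : ctl_run (round_start r).+3 = dovetail (ctl_run (round_start r).+2) by [].
rewrite z2 dovetail_phase2 in z3.
rewrite -/i0 -cE in z1 z2 z3.
set c' := nstep i0 c in z1 z2 z3 simS.
have c'0 : c'.2 = fput (fput (region X i0) c.1.2.+1 (c'.2 c.1.2.+1)) 0 (c'.2 0).
  by rewrite regE; apply: nstep_tape.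
have r1 i : region (ctl_run (round_start r).+1).2 i =
    if i == i0 then fput (region X i0) c.1.2.+1 (c'.2 c.1.2.+1) else region X i.
  by rewrite z1 /= region_fput; case: eqP => // ->.
have r2 i : region (ctl_run (round_start r).+2).2 i = if i == i0 then c'.2 else region X i.
  by rewrite z2 /= !region_fput; case: eqP => // ->; rewrite -c'0.
have r3 i : region (ctl_run (round_start r).+3).2 i = if i == i0 then c'.2 else region X i.
  by rewrite z3 /= !region_fput0 !region_fput; case: eqP => // ->; rewrite -c'0.
have rS i : (if i == i0 then c'.2 else region X i) = (sim i (sim_time i r.+1)).2.
  by case: (eqVneq i i0) => [->|ii]; rewrite ?simS // simO //; have [_ ->] := H i.
split; last first.
  rewrite /round_inv round_startS z3; eexists; split; first by [].
  move=> i; rewrite lookup_cons; split; last first.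
    by have := r3 i; rewrite z3 => ->; apply: rS.
  case: (eqVneq i0 i) => [<-|ii]; first by rewrite simS.
  by have [-> _] := H i; rewrite (simO i) // eq_sym.
split; last split.
- move=> u i m; rewrite round_startS => /andP [u1 u2].
  have : [\/ u = round_start r, u = (round_start r).+1, u = (round_start r).+2
      | u = (round_start r).+3] by case: (ltngtP u (round_start r).+1);
      case: (ltngtP u (round_start r).+2) => ? ?;
      solve [constructor 1; lia|constructor 2; lia|constructor 3; lia|constructor 4; lia].
  case=> ->.
  + by left; have [_ <-] := H i.
  + rewrite r1; case: (eqVneq i i0) => [->|ii]; last by left; have [_ <-] := H i.
    by rewrite simS -regE /fput; case: eqP => [->|_]; [right|left].
  + by right; rewrite r2 rS.
  + by right; rewrite r3 rS.
- move=> u; rewrite round_startS => /andP [u1 u2].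
  have : [\/ u = round_start r, u = (round_start r).+1 | u = (round_start r).+2].
    by case: (ltngtP u (round_start r).+1) => ?;
      solve [constructor 1; lia|constructor 2; lia|constructor 3; lia].
  by case=> ->; rewrite ?z0 ?z1 ?z2 /=.
- by rewrite round_startS z3 z0 /=.
Qed.

Lemma round_inv_all r : round_inv r.
Proof.
elim: r => [|r /round_step [] //]; exists 0.
by rewrite /round_start muln0 ctl_run1; split=> // i; rewrite region_fput0.
Qed.

Lemma round_out_all r : round_out r.
Proof. by have [] := round_step (round_inv_all r). Qed.

Lemma sim_time_mono i r r' : r <= r' -> sim_time i r <= sim_time i r'.
Proof. by elim: r' => [|r' IH]; [case: r|rewrite leq_eqVlt => /orP [/eqP -> //|]; rewrite ltnS => /IH /=; lia]. Qed.

Lemma sim_time_leq i r : sim_time i r <= r.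
Proof. by elim: r => //= r IH; case: (_ == i); lia. Qed.

(** Round [npair i r.+1] belongs to machine [i] and comes after the first [r] rounds. *)
Lemma sim_time_unbounded i s : exists r, s <= sim_time i r.
Proof.
elim: s => [|s [r sr]]; first by exists 0.
exists (npair i r.+1); have := leq_pairr i r.+1.
case E: (npair i r.+1) => [|k'] // rk /=.
rewrite -E nfst_pair eqxx; have := @sim_time_mono i r k' rk; lia.
Qed.

Lemma sim_time_onto i s : exists r, sim_time i r = s.
Proof.
have ex := sim_time_unbounded i s; case: (ex_minnP ex) => -[|r] sr min.
  by exists 0; move: sr => /=; lia.
exists r.+1; apply/eqP; rewrite eqn_leq sr andbT.
have := min r; rewrite ltnn => /contra /=; rewrite -ltnNge => /(_ isT).
by case: (_ == i); lia.
Qed.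

Lemma round_of u : 0 < u -> exists r, round_start r <= u < round_start r.+1.
Proof.
move=> u0; exists (u.-1 %/ 3); rewrite /round_start.
have := divn_eq u.-1 3; have := ltn_pmod u.-1 (isT : 0 < 3); lia.
Qed.

(** An array cell shows the simulated cell before or after the step under way. The number of steps
    made grows without bound and skips no value, which gives the cofinality clauses. *)
Lemma dovetail_tracks i m j :
  tracks (fun u => bit j ((ctl_run u).2 (npair i m).+1)) (fun s => bit j ((sim i s).2 m)).
Proof.
have val u r : round_start r <= u < round_start r.+1 ->
    exists2 s, sim_time i r <= s & (ctl_run u).2 (npair i m).+1 = (sim i s).2 m.
  move=> ur; have [/(_ u i m)] := round_out_all r; case=> [|E|E].
  - by case/andP: ur => -> /ltnW.
  - by exists (sim_time i r).
  - by exists (sim_time i r.+1); [apply: sim_time_mono|].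
split.
- move=> [|u]; first by exists 0.
  by have [//|r /val [s _ E]] := @round_of u.+1; exists s; rewrite E.
- move=> K; have [r Kr] := sim_time_unbounded i K; exists (round_start r) => u ru.
  have [|r' r'u] := @round_of u; first by move: ru; rewrite /round_start; lia.
  have [s rs E] := val _ _ r'u; exists s; last by rewrite E.
  apply: leq_trans Kr (leq_trans (sim_time_mono i _) rs).
  by move: ru r'u; rewrite /round_start; lia.
- move=> s; have [r rs] := sim_time_onto i s; exists (round_start r).
    by rewrite -rs (leq_trans (sim_time_leq i r)) // /round_start; lia.
  have [l [_ /(_ i) [_ E]]] := round_inv_all r.
  by rewrite -[X in bit j X]/(region (ctl_run (round_start r)).2 i m) E rs.
Qed.

(** Time 0 is excluded because the first macro step may raise the flag; later rounds can only lower
    it. *)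
Lemma flag_decreasing u u' : 0 < u <= u' -> bit 0 ((ctl_run u').2 0) ->
  bit 0 ((ctl_run u).2 0).
Proof.
case/andP=> u0 uu'; rewrite -(subnK uu'); elim: (u' - u) => // d IH H; apply: IH.
have [//|r ru] := @round_of (d + u); first by lia.
have [_ [fl fS]] := round_out_all r; rewrite fl //.
case: (ltnP (d + u).+1 (round_start r.+1)) => lt.
  by rewrite -(fl (d + u).+1) //; lia.
move: H; rewrite (_ : d.+1 + u = round_start r.+1); last by lia.
by rewrite fS => /andP [].
Qed.

Lemma flag_first : bit 0 ((ctl_run 1).2 0) = first_flag.
Proof. by rewrite ctl_run1. Qed.

Lemma flag_stays_down u : k <> Some true -> bit 0 (X0 0) = false ->
  bit 0 ((ctl_run u).2 0) = false.
Proof.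
move=> kc f0; case: u => [//|u]; apply/negbTE/negP.
move/(@flag_decreasing 1 u.+1 isT); rewrite flag_first /first_flag f0.
by case: k kc => [[]|].
Qed.

Lemma flag_stays_up u : k = Some true -> (forall i s, ~~ nhalts i (sim i s)) ->
  0 < u -> bit 0 ((ctl_run u).2 0).
Proof.
move=> kc nh u0.
have up r : bit 0 ((ctl_run (round_start r)).2 0).
  elim: r => [|r IH]; first by rewrite /round_start muln0 flag_first /first_flag kc.
  by have [_ [_ ->]] := round_out_all r; rewrite IH nh.
have [//|r ru] := @round_of u.
by have [_ [fl _]] := round_out_all r; rewrite fl.
Qed.

Lemma flag_dropped i s : nhalts i (sim i s) ->
  exists N, forall u, N <= u -> bit 0 ((ctl_run u).2 0) = false.
Proof.
move=> nh.
have [r [ri rs]] : exists r, nfst r.+1 = i /\ sim_time i r = s.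
  (* Take the least number of rounds after which machine [i] has made more than [s] steps: the last
     of these rounds performs step [s]. *)
  have ex := sim_time_unbounded i s.+1; case: (ex_minnP ex) => -[|r] sr min //.
  exists r; have := min r; rewrite ltnn => /contra /=; rewrite -ltnNge => /(_ isT).
  by move: sr => /=; case: (nfst r.+1 =P i) => [->|_] /=; [split=> //|]; lia.
exists (round_start r.+1) => u ru; apply/negbTE/negP.
have ru' : 0 < round_start r.+1 <= u by rewrite ru.
move/(flag_decreasing ru').
by have [_ [_ ->]] := round_out_all r; rewrite ri rs nh.
Qed.
End Dovetail.

(** * Ordinals and cardinals *)

Definition injects (X Y : Type) : Prop := exists f : X -> Y, injective f.

Lemma injects_trans Y X Z : injects X Y -> injects Y Z -> injects X Z.
Proof. by move=> [f fi] [g gi]; exists (g \o f); apply: inj_comp. Qed.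

Lemma card_leTP X Y : ([set: X] #<= [set: Y])%card <-> injects X Y.
Proof.
split=> [/card_leP [f]|[f fi]].
  exists (fun x => val (f (to_setT x))) => x y /val_inj.
  by move=> /('inj_f (mem_set I) (mem_set I)) /(congr1 val).
have e : ((f @` setT)%classic #= [set: X])%card by apply: inj_card_eq => x y _ _ /fi.
apply: card_le_trans (subset_card_le (subsetT (f @` setT)%classic)).
by move: e; rewrite card_eq_le => /andP [].
Qed.

Lemma card_eqTP X Y : ([set: X] #= [set: Y])%card <-> injects X Y /\ injects Y X.
Proof.
by rewrite card_eq_le -!card_leTP; split=> [/andP [] //|[? ?]]; apply/andP.
Qed.

Section Order.
Variable A : ordinal_number.
Implicit Types x y z : A.

Lemma olt_irr x : ~ olt x x.
Proof. by elim/(well_founded_ind (@olt_wf A)): x => x IH xx; exact: (IH x xx xx). Qed.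

Lemma olt_asym x y : olt x y -> ~ olt y x.
Proof. by move=> xy yx; apply: (@olt_irr x); apply: olt_trans xy yx. Qed.

Lemma ole_trans y x z : ole x y -> ole y z -> ole x z.
Proof.
by move=> [->|xy] // [<-|yz]; [right|right; apply: olt_trans xy yz].
Qed.

Lemma ole_olt_trans y x z : ole x y -> olt y z -> olt x z.
Proof. by move=> [->|xy] // yz; apply: olt_trans xy yz. Qed.

Lemma olt_ole_trans y x z : olt x y -> ole y z -> olt x z.
Proof. by move=> xy [<-|yz] //; apply: olt_trans xy yz. Qed.

Lemma olt_ole x y : olt x y \/ ole y x.
Proof. by case: (olt_total x y) => [|[->|]]; [left|right; left|right; right]. Qed.

Lemma ole_not_olt x y : ole x y -> ~ olt y x.
Proof. by move=> xy yx; apply: (@olt_irr x); apply: ole_olt_trans xy yx. Qed.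

Lemma ex_least (P : A -> Prop) : (exists x, P x) ->
  exists x, P x /\ forall y, olt y x -> ~ P y.
Proof.
move=> [x]; elim/(well_founded_ind (@olt_wf A)): x => x IH Px.
have [[y [yx Py]]|n] := pselect (exists y, olt y x /\ P y); first exact: IH yx Py.
by exists x; split=> // y yx Py; apply: n; exists y.
Qed.

Lemma segment_inj x (u v : segment x) : sval u = sval v -> u = v.
Proof. by apply: eq_sig_hprop => *; apply: Prop_irrelevance. Qed.

Lemma injects_segment x : injects (segment x) A.
Proof. by exists sval => u v; apply: segment_inj. Qed.

Lemma segment_mono x y : ole x y -> injects (segment x) (segment y).
Proof.
move=> xy; exists (fun u : segment x => exist (fun z => olt z y) (sval u) (olt_ole_trans (svalP u) xy)) => u v.
by move/(congr1 sval) => /= /segment_inj.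
Qed.

Lemma succ_unique y x x' : is_succ y x -> is_succ y x' -> x = x'.
Proof.
move=> [yx mx] [yx' mx']; case: (olt_total x x') => [lt|[//|lt]].
  by case: (ole_not_olt (mx' _ lt)).
by case: (ole_not_olt (mx _ lt)).
Qed.

Lemma stage_cases x : [\/ is_zero x, exists y, is_succ y x | is_limit x].
Proof.
have [z|nz] := pselect (is_zero x); first by constructor 1.
have [s|ns] := pselect (exists y, is_succ y x); first by constructor 2.
by constructor 3; split=> // y ys; apply: ns; exists y.
Qed.

Lemma limit_succ x y : is_limit x -> olt y x -> exists2 z, is_succ y z & olt z x.
Proof.
move=> [_ nx] yx; have [z [yz mz]] := ex_least (ex_intro (fun z => olt y z) x yx).
have zs : is_succ y z.
  by split=> // w wz; case: (olt_ole y w) => // yw; case: (mz w wz).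
exists z => //; case: (olt_total z x) => [//|[E|xz]]; last by case: (mz x xz).
by case: (nx y); rewrite -E.
Qed.
End Order.

Lemma is_cardinalP A : is_cardinal A <-> forall x : A, ~ injects A (segment x).
Proof.
split=> H x; first by move=> i; apply: (H x); apply/card_eqTP; split=> //; apply: injects_segment.
by move/card_eqTP => [i _]; apply: H i.
Qed.

Lemma countableTP X : countable [set: X] <-> injects X nat.
Proof. exact: card_leTP. Qed.

(** Hilbert's hotel: along a copy of the natural numbers in [X], old guests move to even places and
    the new ones take the odd places. *)
Lemma infinite_add_nat X : ~ injects X nat -> injects (X + nat) X.
Proof.
move=> nX.
have [e ei] : injects nat X.
  by apply/card_leTP/infiniteP => /finite_set_countable /countableTP.
exists (fun u => match u with
  | inl x => if pselect (exists n, e n = x) is left p then e (projT1 (cid p)).*2 else x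
  | inr n => e n.*2.+1 end) => -[x|n] [y|m].
- case: (pselect _) => [p|np]; case: (pselect _) => [p'|np'].
  + move=> /ei /double_inj E; rewrite -(projT2 (cid p)) -(projT2 (cid p')).
    by rewrite E.
  + by move=> E; case: np'; exists (projT1 (cid p)).*2.
  + by move=> E; case: np; exists (projT1 (cid p')).*2.
  + by move=> ->.
- case: (pselect _) => [p /ei|np E]; first by lia.
  by case: np; exists m.*2.+1.
- case: (pselect _) => [p /ei|np E]; first by lia.
  by case: np; exists n.*2.+1.
- by move=> /ei E; congr inr; lia.
Qed.

Definition uncountable_stage (A : ordinal_number) (x : A) : Prop :=
  is_uncountable_cardinal (segment x).

(** An uncountable segment with a last element injects into the segment below that element, so it is
    not an initial ordinal. *)
Lemma uncountable_limit (A : ordinal_number) (x : A) : uncountable_stage x -> is_limit x.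
Proof.
move=> [/is_cardinalP cx]; rewrite countableTP => nx; split.
  move=> z; apply: nx; exists (fun u => False_rect nat (z _ (svalP u))) => u.
  by case: (z _ (svalP u)).
move=> y [yx my].
pose u : segment x := exist _ y yx.
have [f fi] : injects (segment x) (segment u + nat).
  exists (fun w : segment x => if pselect (olt w u) is left p
    then inl (exist (fun z => olt z u) w p : segment u) else inr 0) => v w.
  have top (v' : segment x) : ~ olt v' u -> v' = u.
    move=> nv; apply: segment_inj; case: (my _ (svalP v')) => //.
  by case: pselect => [p|/top ->]; case: pselect => [p'|/top ->] // [].
have nu : ~ injects (segment u) nat.
  move=> [g gi]; apply: nx; apply: injects_trans (ex_intro _ f fi) _.
  exists (fun v => match v with inl w => (g w).*2 | inr n => n.*2.+1 end).
  move=> [a|n] [b|m] E; [congr inl; apply: gi|..]; try lia.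
  by congr inr; lia.
apply: (cx u); apply: injects_trans (infinite_add_nat nu).
by exists f.
Qed.

(** If the segment of [x] injected into a smaller one, so would that of any uncountable cardinal
    lying in between. *)
Lemma uncountable_sup (A : ordinal_number) (x : A) :
  (forall y, olt y x -> exists z, [/\ ole y z, olt z x & uncountable_stage z]) ->
  is_limit x -> uncountable_stage x.
Proof.
move=> H lx; split.
  apply/is_cardinalP => u i.
  have [w uw wx] := limit_succ lx (svalP u).
  have [z [wz zx [/is_cardinalP cz _]]] := H w wx.
  have uz : olt (sval u) z by apply: olt_ole_trans uw.1 wz.
  apply: (cz (exist _ (sval u) uz)).
  apply: injects_trans (segment_mono (or_intror zx)) (injects_trans i _).
  exists (fun v : segment u => exist (fun w => seg_lt w (exist _ (sval u) uz))
    (exist (fun y => olt y z) (sval (sval v)) (olt_trans (svalP v : olt (sval (sval v)) (sval u)) uz))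
    (svalP v : olt (sval (sval v)) (sval u))).
  move=> v w' /(congr1 sval) /(congr1 sval) /= E.
  by apply: (@segment_inj (segment x) u v w'); apply: (@segment_inj A x).
have [y yx] : exists y, olt y x.
  by apply: contrapT => n; apply: lx.1 => y yx; apply: n; exists y.
have [z [_ zx [_ uz]]] := H y yx.
rewrite countableTP => i; apply: uz; rewrite countableTP.
exact: injects_trans (segment_mono (or_intror zx)) i.
Qed.

Definition equipotent (X Y : Type) : Prop := injects X Y /\ injects Y X.

Lemma segment_segment (A : ordinal_number) (x : A) (u : segment x) :
  equipotent (segment u) (segment (sval u)).
Proof.
split.
  exists (fun v : segment u => exist (fun z => olt z (sval u)) (sval (sval v))
    (svalP v : olt (sval (sval v)) (sval u))) => v w /(congr1 sval) /= E.
  by apply: (@segment_inj (segment x) u v w); apply: (@segment_inj A x).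
exists (fun v : segment (sval u) =>
  exist (fun z => seg_lt z u) (exist (fun z => olt z x) (sval v)
    (olt_trans (svalP v) (svalP u))) (svalP v)) => v w /(congr1 sval) /(congr1 sval) /=.
exact: segment_inj.
Qed.

(** Equipotence alone does not preserve being an initial ordinal; the proper segments have to be
    compared as well. *)
Lemma uncountable_cardinal_transfer (A B : ordinal_number) : equipotent A B ->
  (forall y : B, exists x : A, injects (segment y) (segment x)) ->
  is_uncountable_cardinal A -> is_uncountable_cardinal B.
Proof.
move=> [AB BA] H [/is_cardinalP cA]; rewrite countableTP => uA; split.
  apply/is_cardinalP => y i; have [x yx] := H y; apply: (cA x).
  exact: injects_trans AB (injects_trans i yx).
by rewrite countableTP => i; apply: uA; apply: injects_trans AB i.
Qed.

(** * Embeddings of an ordinal onto an initial segment of another *)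

Definition initial (A B : ordinal_number) (f : A -> B) : Prop :=
  (forall x y, olt x y -> olt (f x) (f y)) /\
  forall x z, olt z (f x) -> exists y, f y = z.

Section Initial.
Variables (A B : ordinal_number) (f : A -> B) (fI : initial f).

Lemma initial_lt x y : olt (f x) (f y) -> olt x y.
Proof.
move=> xy; case: (olt_total x y) => [//|[E|yx]].
  by case: (@olt_irr _ (f x)); rewrite {2}E.
by case: (olt_asym xy (fI.1 _ _ yx)).
Qed.

Lemma initial_inj : injective f.
Proof.
move=> x y E; case: (olt_total x y) => [/fI.1|[//|/fI.1]]; rewrite E => H;
  by case: (olt_irr H).
Qed.

Lemma initial_below x z : olt z (f x) -> exists2 y, olt y x & f y = z.
Proof. by move=> zx; have [y E] := fI.2 _ _ zx; exists y => //; apply: initial_lt; rewrite E. Qed.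

Lemma initial_le x y : ole x y -> ole (f x) (f y).
Proof. by case=> [->|/fI.1]; [left|right]. Qed.

Lemma initial_zero x : is_zero x -> is_zero (f x).
Proof. by move=> z y /initial_below [w /z]. Qed.

Lemma initial_succ y x : is_succ y x -> is_succ (f y) (f x).
Proof.
move=> [yx m]; split; first exact: fI.1.
by move=> z /initial_below [w /m wy <-]; apply: initial_le.
Qed.

Lemma initial_limit x : is_limit x -> is_limit (f x).
Proof.
move=> [nz ns]; split.
  move=> z; apply: nz => y /fI.1; apply: z.
move=> z [zx m]; have [w wx E] := initial_below zx; apply: (ns w); split=> // v vx.
case: (olt_ole w v) => // wv; have := m _ (fI.1 _ _ vx); rewrite -E => /ole_not_olt.
by case; apply: fI.1.
Qed.

Lemma initial_limsup x (g : B -> bool) : limsup_at (f x) g = limsup_at x (g \o f).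
Proof.
apply: asbool_equiv_eq; split=> H y yx.
  have [z [yz zx gz]] := H (f y) (fI.1 _ _ yx).
  have [w wx E] := initial_below zx; exists w; split=> //; last by rewrite /= E.
  case: (olt_ole w y) => // /fI.1; rewrite E => zy.
  by case: (ole_not_olt yz zy).
have [w wx E] := initial_below yx; have [z [wz zx gz]] := H w wx.
exists (f z); split=> //; last exact: fI.1.
by rewrite -E; apply: initial_le.
Qed.

Lemma initial_segment x : equipotent (segment x) (segment (f x)).
Proof.
split.
  exists (fun u : segment x => exist (fun z => olt z (f x)) (f (sval u)) (fI.1 _ _ (svalP u))).
  by move=> u v /(congr1 sval) /= /initial_inj; apply: segment_inj.
have ex (v : segment (f x)) : exists u : segment x, f (sval u) = sval v.
  by have [w wx E] := initial_below (svalP v); exists (exist _ w wx).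
have [g gE] := choice ex.
by exists g => u v E; apply: segment_inj; rewrite -!gE E.
Qed.

Lemma initial_uncountable x : uncountable_stage (f x) <-> uncountable_stage x.
Proof.
have [xf fx] := initial_segment x; split; apply: uncountable_cardinal_transfer => //.
- move=> u; exists (exist _ (f (sval u)) (fI.1 _ _ (svalP u))).
  have [s1 _] := segment_segment u; have [s2 _] := initial_segment (sval u).
  apply: injects_trans s1 (injects_trans s2 _).
  exact: (segment_segment (exist (fun z => olt z (f x)) _ _)).2.
- move=> v; have [w wx E] := initial_below (svalP v).
  exists (exist _ w wx); have [s1 _] := segment_segment v.
  have [_ s2] := initial_segment w; rewrite E in s2.
  apply: injects_trans s1 (injects_trans s2 _).
  exact: (segment_segment (exist (fun z => olt z x) w wx)).2.
Qed.
End Initial.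

Lemma initial_inl (A B : ordinal_number) : initial (inl : A -> ord_add A B).
Proof.
split=> [x y xy|x [z|z] H]; [by constructor|by exists z|by inversion H].
Qed.

(* Send each element to the least one not yet used; [inr tt] is the overflow. *)
Lemma comparable_ordinals (A B : ordinal_number) :
  (exists f : A -> B, initial f) \/ (exists f : B -> A, initial f).
Proof.
pose C := ord_add B ord_one.
have top (z : C) : ole z (inr tt) by case: z => [z|[]]; [right; constructor|left].
pose fresh (x : A) (rec : forall y, olt y x -> C) (z : C) : Prop :=
  (forall y (yx : olt y x), olt (rec y yx) z) \/ z = inr tt.
have ex x rec : exists z, fresh x rec z /\ forall w, olt w z -> ~ fresh x rec w.
  by apply: ex_least; exists (inr tt); right.
pose body x rec := projT1 (cid (ex x rec)).
pose g := Fix (@olt_wf A) (fun=> ord_sort C) body.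
have gE x : g x = body x (fun y _ => g y).
  by rewrite /g Fix_eq // => x' h h' hh; congr body; do 2!apply: functional_extensionality_dep => ?.
have g1 x : (forall y, olt y x -> olt (g y) (g x)) \/ g x = inr tt.
  by rewrite gE /body; case: cid => z [fz _] /=.
have g2 x w : olt w (g x) -> exists2 y, olt y x & ole w (g y).
  rewrite gE /body; case: cid => z [_ m] /= /m nf; apply: contrapT => ne.
  by apply: nf; left=> y yx; case: (olt_ole (g y) w) => // wy; case: ne; exists y.
have onto x : forall w, olt w (g x) -> exists2 y, olt y x & g y = w.
  elim/(well_founded_ind (@olt_wf A)): x => x IH w /g2 [y yx [->|wy]]; first by exists y.
  by have [y' y'y <-] := IH y yx w wy; exists y' => //; apply: olt_trans y'y yx.
have [[x0 x0E]|nt] := pselect (exists x, g x = inr tt).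
  (* At the least overflow all of [B] has been used up, so [B] is a copy of the part of [A] below
     [x]. *)
  have [x [xE mx]] := ex_least (ex_intro (fun x => g x = inr tt) x0 x0E).
  have exb (b : B) : exists2 y, olt y x & g y = inl b.
    by apply: onto; rewrite xE; constructor.
  have [h hx hE] : exists2 h : B -> A, (forall b, olt (h b) x) & forall b, g (h b) = inl b.
    have exb' (b : B) : exists y, olt y x /\ g y = inl b by have [y] := exb b; exists y.
    by have [h hP] := choice exb'; exists h => b; have [] := hP b.
  right; exists h; split=> [b b' bb'|b z zb].
    case: (olt_total (h b) (h b')) => [//|[E|lt]].
      have := hE b; rewrite E hE => -[E']; rewrite E' in bb'.
      by case: (olt_irr bb').
    have [/(_ _ lt)|] := g1 (h b); rewrite !hE // => H.
    have lt' : olt (inl b : C) (inl b') by constructor.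
    by case: (olt_asym lt' H).
  have zx := olt_trans zb (hx b).
  case E: (g z) => [b'|[]]; last by case: (mx z zx).
  exists b'; case: (olt_total (h b') z) => [lt|[//|lt]].
    by have [/(_ _ lt)|] := g1 z; rewrite E ?hE // => /olt_irr.
  by have [/(_ _ lt)|] := g1 (h b'); rewrite ?E hE // => /olt_irr.
left; have exg x : exists b, g x = inl b.
  by case E: (g x) => [b|[]]; [exists b|case: nt; exists x].
have [h hE] := choice exg; exists h; split=> [x y xy|x b bx].
  have [/(_ _ xy)|] := g1 y; rewrite !hE // => H; by inversion H.
have lt : olt (inl b : C) (g x) by rewrite hE; constructor.
by have [y _ E] := onto x _ lt; exists y; move: E; rewrite hE => -[].
Qed.

(** * Transfinite runs *)

Definition blank : tape := fun=> (false, false, false).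

Definition limit_tape (A : ordinal_number) (x : A) (t : A -> tape) : tape :=
  fun i => (limsup_at x (fun y => bit 0 (t y i)), limsup_at x (fun y => bit 1 (t y i)),
            limsup_at x (fun y => bit 2 (t y i))).

Lemma bit_limit_tape (A : ordinal_number) (x : A) (t : A -> tape) j i :
  bit j (limit_tape x t i) = limsup_at x (fun y => bit j (t y i)).
Proof. by case: j => [|[|j]]. Qed.

Lemma limsup_ext (A : ordinal_number) (x : A) (f g : A -> bool) :
  (forall y, olt y x -> f y = g y) -> limsup_at x f = limsup_at x g.
Proof.
move=> E; apply: asbool_equiv_eq; split=> H y yx; have [z [yz zx fz]] := H y yx;
  by exists z; split=> //; rewrite ?E // -E.
Qed.

Lemma limit_tape_ext (A : ordinal_number) (x : A) (t t' : A -> tape) :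
  (forall y, olt y x -> t y = t' y) -> limit_tape x t = limit_tape x t'.
Proof.
by move=> E; apply/funext => i; rewrite /limit_tape; congr (_, _, _);
  apply: limsup_ext => y yx; rewrite E.
Qed.

Section Run.
Variables (S : Type) (st : kind -> S) (step : S * nat * tape -> S * nat * tape).

Record abstract_run (A : ordinal_number) (c : A -> S * nat * tape) : Prop := {
  arun_zero : forall x, is_zero x -> c x = (st None, 0, blank);
  arun_succ : forall y x, is_succ y x -> c x = step (c y);
  arun_limit : forall x, is_limit x ->
    c x = (st (Some `[< uncountable_stage x >]), 0, limit_tape x (fun y => (c y).2))
}.

(** A configuration depends only on the order type of its stage. This is what lets statements about
    a stage move between ambient ordinals. *)
Lemma arun_initial (A B : ordinal_number) (f : A -> B) c d : initial f ->
  abstract_run (A := A) c -> abstract_run (A := B) d -> forall x, d (f x) = c x.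
Proof.
move=> fI [cz cs cl] [dz ds dl] x; elim/(well_founded_ind (@olt_wf A)): x => x IH.
case: (stage_cases x) => [z|[y s]|l].
- by rewrite cz // dz //; apply: initial_zero.
- by rewrite (cs _ _ s) (ds _ _ (initial_succ fI s)) IH //; case: s.
rewrite cl // (dl _ (initial_limit fI l)); congr (st (Some _), _, _).
  exact: asbool_equiv_eq (initial_uncountable fI x).
apply/funext => i; rewrite /limit_tape !(initial_limsup fI); congr (_, _, _);
  by apply: limsup_ext => y yx /=; rewrite IH.
Qed.

Section Existence.
Variable A : ordinal_number.

Definition run_body (x : A) (rec : forall y, olt y x -> S * nat * tape) : S * nat * tape :=
  let c y := if pselect (olt y x) is left p then rec y p else (st None, 0, blank) in
  if pselect (is_zero x) then (st None, 0, blank) else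
  if pselect (exists y, is_succ y x) is left p then step (c (projT1 (cid p))) else
  (st (Some `[< uncountable_stage x >]), 0, limit_tape x (fun y => (c y).2)).

Definition run : A -> S * nat * tape :=
  Fix (@olt_wf A) (fun=> (S * nat * tape)%type) run_body.

Lemma run_is_run : abstract_run run.
Proof.
have E x : run x = run_body (fun y (_ : olt y x) => run y).
  rewrite /run Fix_eq // => x' h h' hh; congr run_body.
  by do 2!apply: functional_extensionality_dep => ?.
split=> [x z|y x s|x l]; rewrite E /run_body; case: (pselect (is_zero x)) => //.
- by move=> z; case: (z y s.1).
- move=> nz /=; case: (pselect (exists y, is_succ y x)) => [p|[]]; last by exists y.
  case: (cid p) => w [wx mw] /=; have [yx my] := s.
  have -> : w = y by case: (mw _ yx) => [//|yw]; case: (ole_not_olt (my _ wx)).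
  by case: (pselect (olt y x)) => //; case; case: s.
- by case: l.
move=> nz /=; case: (pselect (exists y, is_succ y x)) => [[y s]|ns] /=; first by case: (l.2 y).
congr (_, _, _); apply: limit_tape_ext => y yx.
by case: (pselect (olt y x)).
Qed.
End Existence.

Lemma run_initial (A B : ordinal_number) (f : A -> B) x : initial f -> run (f x) = run x.
Proof. by move=> fI; apply: (arun_initial fI); apply: run_is_run. Qed.
End Run.

(** * Blocks of length omega *)

Section Blocks.
Variable A : ordinal_number.
Implicit Types b x y z : A.

Definition block_start_at b : Prop := is_zero b \/ is_limit b.

Inductive after b : nat -> A -> Prop :=
| after0 : after b 0 b
| afterS n y z : after b n y -> is_succ y z -> after b n.+1 z.

Lemma after_ex x : exists b n, block_start_at b /\ after b n x.
Proof.
elim/(well_founded_ind (@olt_wf A)): x => x IH; case: (stage_cases x) => [z|[y s]|l].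
- by exists x, 0; split; [left|constructor].
- have [b [n [B a]]] := IH y s.1; exists b, n.+1; split=> //; exact: afterS a s.
- by exists x, 0; split; [right|constructor].
Qed.

Lemma after_unique b n y z : after b n y -> after b n z -> y = z.
Proof.
elim: n y z => [|n IH] y z; first by move=> H1 H2; inversion H1; inversion H2; subst.
move=> H1 H2; inversion H1 as [|? y' ? a1 s1]; inversion H2 as [|? z' ? a2 s2]; subst.
by move: (IH _ _ a1 a2) s1 => -> s1; apply: succ_unique s1 s2.
Qed.

Lemma after_mono b n m y z : after b n y -> after b m z -> n <= m -> ole y z.
Proof.
move=> ay az nm; elim: az nm => [|m' z' z'' a IH s] nm.
  by move: nm ay; rewrite leqn0 => /eqP -> H; inversion H; left.
move: nm; rewrite leq_eqVlt => /orP [/eqP E|]; last first.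
  by rewrite ltnS => /IH yz; apply: ole_trans yz _; right; case: s.
by subst n; left; apply: after_unique ay (afterS a s).
Qed.

Lemma after_ge b n y : after b n y -> ole b y.
Proof. by move=> a; apply: after_mono (after0 b) a _. Qed.

Lemma after_below b b' n y : block_start_at b' -> olt b b' -> after b n y -> olt y b'.
Proof.
move=> B bb'; elim=> [//|m z w _ zb' s].
case: B => [z0|l]; first by case: (z0 _ bb').
by have [v sv vb] := limit_succ l zb'; rewrite (succ_unique s sv).
Qed.

Lemma after_total b x n : is_limit x -> olt b x -> exists2 z, after b n z & olt z x.
Proof.
move=> l bx; elim: n => [|n [z az zx]]; first by exists b => //; constructor.
by have [w s wx] := limit_succ l zx; exists w => //; apply: afterS az s.
Qed.

(** Either another block begins between [y] and [x], and true values occur in blocks beyond [y], or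
    [y] lies in the last block below [x], and true values are cofinal in that block. *)
Lemma limsup_cases x (f : A -> bool) : is_limit x -> limsup_at x f -> forall y, olt y x ->
  (exists b n z, [/\ block_start_at b, olt y b, olt b x, after b n z & f z]) \/
  (exists b N, [/\ block_start_at b, olt b x, after b N y &
     forall N', exists n z, [/\ N' <= n, after b n z & f z]]).
Proof.
move=> l /asboolP L y yx.
have [[b' [B' yb' b'x]]|nb] := pselect (exists b', [/\ block_start_at b', olt y b' & olt b' x]).
  left; have [z [bz zx fz]] := L b' b'x; have [b [n [B a]]] := after_ex z.
  exists b, n, z; split=> //; last exact: ole_olt_trans (after_ge a) zx.
  case: (olt_ole b b') => [lt|le]; last exact: olt_ole_trans yb' le.
  by case: (ole_not_olt bz (after_below B' lt a)).
right; have [b [N [B a]]] := after_ex y; have bx := ole_olt_trans (after_ge a) yx.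
exists b, N; split=> // N'.
have [w aw wx] := after_total (maxn N N') l bx.
have [z [wz zx fz]] := L w wx; have [b' [n [B' a']]] := after_ex z.
have b'x := ole_olt_trans (after_ge a') zx.
have bE : b' = b.
  case: (olt_total b' b) => [lt|[//|lt]].
    have zw := olt_ole_trans (after_below B lt a') (after_ge aw).
    by case: (ole_not_olt wz zw).
  by case: nb; exists b'; split=> //; apply: after_below lt a.
subst b'; exists n, z; split=> //.
case: (ltnP n N') => // nN.
have nw : n <= maxn N N' by lia.
have [E|zw] := after_mono a' aw nw; last by case: (ole_not_olt wz zw).
subst w; have : n = maxn N N'; last by lia.
clear -a' aw.
suff inj m m' u : after b m u -> after b m' u -> m <= m' -> m = m'.
  by case: (leqP n (maxn N N')) => [/(inj _ _ _ a' aw) //|/ltnW /(inj _ _ _ aw a')].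
move=> am am' mm'; case: (ltngtP m m') mm' => // lt _.
inversion am' as [E1 E2|k v ? av s]; subst; first by [].
by case: (ole_not_olt (after_mono am av lt) s.1).
Qed.

(** At a limit of limits it matters only whether a value occurs in a block, at the end of a single
    block whether it occurs cofinally. [tracks] preserves both. *)
Lemma limsup_blocks x (f g : A -> bool) : is_limit x ->
  (forall b, block_start_at b -> olt b x ->
     ((exists n z, after b n z /\ f z) -> exists n z, after b n z /\ g z) /\
     ((forall N, exists n z, [/\ N <= n, after b n z & f z]) ->
       forall N, exists n z, [/\ N <= n, after b n z & g z])) ->
  limsup_at x f -> limsup_at x g.
Proof.
move=> l H L; apply/asboolP => y yx.
case: (limsup_cases l L yx) => [[b [n [z [B yb bx a fz]]]]|[b [N [B bx a c]]]].
  have [n' [z' [a' gz]]] := (H b B bx).1 (ex_intro _ n (ex_intro _ z (conj a fz))).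
  exists z'; split=> //; last exact: after_below (or_intror l) bx a'.
  by right; apply: olt_ole_trans yb (after_ge a').
have [n [z [Nn a' gz]]] := (H b B bx).2 c N.
exists z; split=> //; first exact: after_mono a a' Nn.
exact: after_below (or_intror l) bx a'.
Qed.

Lemma run_after S (st : kind -> S) step b n x : after b n x ->
  run st step x = iter n step (run st step b).
Proof.
elim=> // m y z _ IH s.
by rewrite (arun_succ (run_is_run st step A) s) IH.
Qed.
End Blocks.

(** * Arbitrarily large cardinals *)

Lemma well_order_ordinal (T : Type) : exists A : ordinal_number, ord_sort A = T.
Proof.
have [R wo] := well_ordering_principle {classic T}.
have min2 (P : pred {classic T}) a : P a -> exists2 z, P z & forall x, P x -> R z x.
  by move=> Pa; have [|z [[Pz lz] _]] := wo P; [exists a|exists z].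
have refl a : R a a by have [|z /eqP -> ->] := @min2 (pred1 a) a; rewrite /= ?eqxx.
have total a b : R a b \/ R b a.
  have [|z /orP [] /eqP -> lz] := @min2 (fun x => (x == a) || (x == b)) a.
  - by rewrite eqxx.
  - by left; apply: lz; rewrite eqxx orbT.
  - by right; apply: lz; rewrite eqxx.
have anti a b : R a b -> R b a -> a = b.
  move=> ab ba; have [|z [_ u]] := wo (fun x => (x == a) || (x == b)).
    by exists a; rewrite unfold_in eqxx.
  rewrite -(u a) ?(u b) //; split; rewrite ?unfold_in ?eqxx ?orbT // => x;
    by rewrite unfold_in => /orP [] /eqP ->.
have trans b a c : R a b -> R b c -> R a c.
  move=> ab bc.
  have [|z Pz lz] := @min2 (fun x => [|| x == a, x == b | x == c]) a; first by rewrite eqxx.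
  have [za [zb zc]] : R z a /\ R z b /\ R z c by rewrite !lz ?eqxx ?orbT.
  case/or3P: Pz => /eqP E; subst z; first by [].
    by rewrite (anti _ _ ab za).
  by rewrite -(anti _ _ bc zb).
pose lt (a b : {classic T}) : Prop := R a b /\ a <> b.
have lt_wf : well_founded lt.
  move=> a; apply: contrapT => na.
  have [|z /asboolP nz lz] := @min2 (fun x => `[< ~ Acc lt x >]) a; first exact/asboolP.
  apply: nz; constructor=> y [yz ne]; apply: contrapT => ny.
  by apply: ne; apply: anti yz _; apply: lz; apply/asboolP.
have lt_trans a b c : lt a b -> lt b c -> lt a c.
  move=> [ab nab] [bc nbc]; split; first exact: trans ab bc.
  by move=> E; subst c; apply: nab; apply: anti.
have lt_total a b : lt a b \/ a = b \/ lt b a.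
  have [->|ne] := pselect (a = b); first by right; left.
  by case: (total a b) => H; [left|right; right]; split=> // E; apply: ne.
by exists (OrdinalNumber lt_wf lt_trans lt_total).
Qed.

Lemma cantor_injects X : ~ injects (set X) X.
Proof.
move=> [F Fi]; pose D : set X := fun x => exists2 Y : set X, F Y = x & ~ Y x.
have [DD|nD] := pselect (D (F D)); last by apply: (nD); exists D.
by case: (DD) => Y /Fi ->.
Qed.

(** Well-order the power set of [X]. The least proper segment into which the whole injects is a
    cardinal; if there is none, the whole is one. *)
Lemma large_cardinal X : exists A : ordinal_number, is_cardinal A /\ ~ injects A X.
Proof.
have [W WE] := well_order_ordinal (set X).
have nW : ~ injects W X by rewrite WE; apply: cantor_injects.
have [ex|ne] := pselect (exists x : W, injects W (segment x)); last first.
  by exists W; split=> //; apply/is_cardinalP => x i; apply: ne; exists x.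
have [x [ix mx]] := ex_least ex; exists (segment x); split; last first.
  by move=> i; apply: nW; apply: injects_trans ix i.
apply/is_cardinalP => u i; apply: (mx (sval u) (svalP u)).
exact: injects_trans ix (injects_trans i (segment_segment u).1).
Qed.

(** * Programs as numbered machines *)

Section Program.
Variable p : program.
Local Notation n := (nstates p).

Definition to_abstract (c : config n) : state n * nat * tape :=
  (cstate c, chead c, fun i => (tape1 c i, tape2 c i, tape3 c i)).

Definition of_abstract (c : state n * nat * tape) : config n :=
  Config c.1.1 c.1.2 (fun i => bit 0 (c.2 i)) (fun i => bit 1 (c.2 i))
    (fun i => bit 2 (c.2 i)).

Lemma to_abstract_step c :
  to_abstract (step c) = tm_step (@trans p) (to_abstract c).
Proof.
rewrite /to_abstract /step /tm_step /=.
case: (trans _ _) => [[q [[b1 b2] b3]] d] /=; congr pair.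
by apply/funext => i; rewrite /write_cell /fput; case: eqP.
Qed.

Lemma of_abstract_step c :
  of_abstract (tm_step (@trans p) c) = step (of_abstract c).
Proof.
case: c => [[q h] t]; rewrite /of_abstract /step /tm_step /=.
have -> : ((t h).1.1, (t h).1.2, (t h).2) = t h by case: (t h) => [[]].
case: (trans _ _) => [[q' [[b1 b2] b3]] d] /=.
by congr Config; apply/funext => i; rewrite /write_cell /fput; case: eqP.
Qed.

Lemma is_run_abstract (A : ordinal_number) (c : A -> config n) : is_run c ->
  abstract_run (@kind_state n) (tm_step (@trans p)) (to_abstract \o c).
Proof.
case=> cz cs cc cl; split=> [x z|y x s|x l] /=.
- by rewrite cz.
- by rewrite (cs _ _ s) to_abstract_step.
have [u|nu] := pselect (uncountable_stage x).
  by rewrite (cc x u) asboolT.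
by rewrite (cl x l nu) asboolF.
Qed.

Lemma abstract_is_run (A : ordinal_number) (c : A -> state n * nat * tape) :
  abstract_run (@kind_state n) (tm_step (@trans p)) c -> is_run (of_abstract \o c).
Proof.
case=> cz cs cl; split=> [x z|y x s|x u|x l nu] /=.
- by rewrite cz.
- by rewrite (cs _ _ s) of_abstract_step.
- by rewrite cl ?asboolT //; apply: uncountable_limit.
- by rewrite cl ?asboolF.
Qed.

Definition state_code (q : state n) : nat :=
  match q with
  | q_start => 0 | q_halt => 1 | q_limit => 2 | q_cardinal => 3 | q_other i => 4 + i
  end.

Lemma state_code_inj : injective state_code.
Proof. by move=> [||||i] [||||j] //= [/val_inj ->]. Qed.

Lemma state_code_kind k : state_code (kind_state n k) = kind_code k.
Proof. by case: k => [[]|]. Qed.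

Definition row_key (x : state n * symbols) : nat := npair (state_code x.1) (scode x.2).

Definition row_value (x : state n * symbols) : nat :=
  let: (q, s, d) := trans x.1 x.2 in
  npair (state_code q) (npair (bit 0 s) (npair (bit 1 s) (npair (bit 2 s)
    (if d is go_right then 1 else 0)))).

Lemma row_key_inj : injective row_key.
Proof.
move=> [q s] [q' s'] /eqP; rewrite /row_key npair_eq => /andP [/eqP /state_code_inj /= ->].
by move=> /eqP /scode_inj /= ->.
Qed.

Lemma In_mem (T : eqType) (x : T) (s : seq T) : x \in s -> List.In x s.
Proof.
by elim: s => //= y s IH; rewrite in_cons => /orP [/eqP ->|/IH]; [left|right].
Qed.

Lemma nget_table (T : Type) (key val : T -> nat) (s : seq T) x :
  injective key -> List.In x s ->
  nget (foldr (fun y l => nacons (key y) (val y) l) 0 s) (key x) = (val x).+1.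
Proof.
move=> ki; elim: s => //= y s IH H; rewrite nget_cons.
by case: eqP => [/ki -> //|ne]; apply: IH; case: H => // E; case: ne; rewrite E.
Qed.

Lemma program_table : exists i, forall q s,
  table_entry i (state_code q) s = row_value (q, s).
Proof.
pose states : seq (state n) :=
  [:: q_start, q_halt, q_limit, q_cardinal & List.map (@q_other n) (enum 'I_n)].
pose rows := List.list_prod states (enum {: symbols}).
exists (foldr (fun y l => nacons (row_key y) (row_value y) l) 0 rows) => q s.
rewrite /table_entry -[npair _ _]/(row_key (q, s)) (nget_table _ row_key_inj) //.
apply: List.in_prod; last by apply: In_mem; rewrite mem_enum.
case: q => [||||i] /=; try tauto.
by do 4!right; apply: List.in_map; apply: In_mem; rewrite mem_enum.
Qed.

Section Table.
Variables (i : nat) (iE : forall q s, table_entry i (state_code q) s = row_value (q, s)).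

Lemma nstep_program q h t T : (forall m, T m.+1 = t m) ->
  let c := tm_step (@trans p) (q, h, t) in
  let d := nstep i (state_code q, h, T) in
  [/\ d.1.1 = state_code c.1.1, d.1.2 = c.1.2, (forall m, d.2 m.+1 = c.2 m) &
      bit 0 (d.2 0) = (d.1.1 == 1) || bit 0 (T 0)].
Proof.
move=> TE /=; rewrite iE TE /row_value /=.
case: (trans q (t h)) => [[q' s'] d'] /=; rewrite !npairE; split=> //.
- by case: d'.
- move=> m; rewrite /fput /= eqSS; case: eqP => // _.
  by case: s' => [[[] []] []].
Qed.

(** The last clause keeps the added flag down until the program makes a halting transition, so that
    this transition counts as a first halt. *)
Lemma nrun_program (A : ordinal_number) (d : A -> state n * nat * tape) :
  abstract_run (@kind_state n) (tm_step (@trans p)) d ->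
  forall x, let c := run kind_code (nstep i) x in
  [/\ c.1.1 = state_code (d x).1.1, c.1.2 = (d x).1.2, (forall m, c.2 m.+1 = (d x).2 m) &
      (forall y, olt y x -> (tm_step (@trans p) (d y)).1.1 <> q_halt) ->
      bit 0 (c.2 0) = false].
Proof.
move=> [dz ds dl] x; have [rz rs rl] := run_is_run kind_code (nstep i) A.
elim/(well_founded_ind (@olt_wf A)): x => x IH; cbv zeta.
case: (stage_cases x) => [z|[y s]|l].
- by rewrite rz // dz.
- rewrite (rs _ _ s) (ds _ _ s); have [e1 e2 e3 e4] := IH y s.1.
  have := nstep_program (d y).1.1 (d y).1.2 e3.
  rewrite -e1 -!surjective_pairing -e2 -!surjective_pairing.
  move=> [f1 f2 f3 f4]; split=> // nh; rewrite f4 e4 ?orbF; last first.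
    by move=> w wy; apply: nh; apply: olt_trans wy s.1.
  rewrite f1; apply/eqP => E; apply: (nh y s.1).
  by apply: state_code_inj; rewrite E.
- rewrite rl // dl //; split=> //.
  + by rewrite state_code_kind.
  + move=> m; rewrite /limit_tape; congr (_, _, _); apply: limsup_ext => y yx;
      by have [_ _ -> _] := IH y yx.
  + move=> nh; rewrite bit_limit_tape; apply/negbTE/negP => /asboolP H.
    have [y yx] : exists y, olt y x.
      by apply: contrapT => ne; apply: l.1 => y yx; apply: ne; exists y.
    have [z [_ zx]] := H y yx; have [_ _ _ ->] := IH z zx; first by [].
    by move=> w wz; apply: nh; apply: olt_trans wz zx.
Qed.
End Table.
End Program.

(** * The simulator along a transfinite run *)

Definition nrun (i : nat) (A : ordinal_number) (x : A) : nat * nat * tape :=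
  run kind_code (nstep i) x.

Definition stage_kind (A : ordinal_number) (x : A) : kind :=
  if `[< is_zero x >] then None else Some `[< uncountable_stage x >].

Lemma run_block_start S (st : kind -> S) step (A : ordinal_number) (b : A) :
  block_start_at b -> run st step b = (st (stage_kind b), 0, (run st step b).2).
Proof.
have [rz _ rl] := run_is_run st step A; rewrite /stage_kind => -[z|l].
  by rewrite rz // asboolT.
by rewrite rl // (asboolF l.1).
Qed.

Section Simulation.
Variables (M : program) (K : nat).
Hypothesis halt_cases : forall q s, (@trans M q s).1.1 = q_halt ->
  q = q_halt \/ q = q_limit /\ bit 0 s.
Hypothesis not_limit : forall q s, (@trans M q s).1.1 <> q_limit.
Hypothesis block_spec : forall k t, clean K t -> (k = Some false -> bit 0 (t 0) = false) ->
  let c m := iter m (tm_step (@trans M)) (kind_state _ k, 0, t) in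
  (forall m, clean K (c m).2) /\
  forall p j, tracks (fun m => bit j ((c m).2 (K.+1 * p)))
    (fun i => bit j ((ctl_run k (array_of K t) i).2 p)).

Variable A : ordinal_number.
Local Notation mstep := (tm_step (@trans M)).
Local Notation mrun := (run (@kind_state (nstates M)) mstep).
Implicit Types b x y z : A.

Definition block_inv b : Prop := clean K (mrun b).2 /\
  forall i m, (mrun b).2 (K.+1 * (npair i m).+1) = (nrun i b).2 m.

(** Nothing is claimed at an uncountable cardinal, where earlier flags may accumulate; the flag is
    raised there anyway. *)
Definition flag_inv b : Prop :=
  ~ uncountable_stage b -> bit 0 ((mrun b).2 0) = false.

Section OneBlock.
Variable b : A.
Hypotheses (B : block_start_at b) (binv : block_inv b) (finv : flag_inv b).

Let X0 := array_of K (mrun b).2.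

Lemma stage_kind_flag : stage_kind b = Some false -> bit 0 ((mrun b).2 0) = false.
Proof.
rewrite /stage_kind; case: asboolP => // _ [u]; apply: finv => /asboolP.
by rewrite u.
Qed.

Lemma block_run_spec : let c m := iter m mstep (mrun b) in
  (forall m, clean K (c m).2) /\
  forall p j, tracks (fun m => bit j ((c m).2 (K.+1 * p)))
    (fun i => bit j ((ctl_run (stage_kind b) X0 i).2 p)).
Proof.
rewrite (run_block_start _ _ B).
exact: block_spec binv.1 stage_kind_flag.
Qed.

Lemma sim_nrun i s : sim (stage_kind b) X0 i s = iter s (nstep i) (nrun i b).
Proof.
rewrite /sim /nrun [in RHS](run_block_start _ _ B); congr (iter _ _ (_, _, _)).
by apply/funext => m; rewrite /region /X0 /array_of binv.2.
Qed.

Lemma block_region_tracks i m j :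
  tracks (fun n => bit j ((iter n mstep (mrun b)).2 (K.+1 * (npair i m).+1)))
    (fun s => bit j ((iter s (nstep i) (nrun i b)).2 m)).
Proof.
apply: tracks_trans (block_run_spec.2 _ _) _.
have := dovetail_tracks (stage_kind b) X0 i m j.
by under [X in tracks _ X]funext => s do rewrite sim_nrun.
Qed.

Lemma block_flag_tracks :
  tracks (fun n => bit 0 ((iter n mstep (mrun b)).2 0))
    (fun u => bit 0 ((ctl_run (stage_kind b) X0 u).2 0)).
Proof. by have := block_run_spec.2 0 0; rewrite muln0. Qed.

Lemma block_flag_down n : ~ uncountable_stage b ->
  bit 0 ((iter n mstep (mrun b)).2 0) = false.
Proof.
move=> nu; apply/negbTE/negP => H.
have [u] := tracks_sup block_flag_tracks (ex_intro _ n H).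
rewrite flag_stays_down //; last by rewrite /X0 /array_of muln0; apply: finv.
by rewrite /stage_kind; case: asboolP => // _ [/asboolP].
Qed.

Lemma stage_kind_uncountable : uncountable_stage b -> stage_kind b = Some true.
Proof.
by move=> u; rewrite /stage_kind (asboolF (uncountable_limit u).1) asboolT.
Qed.

Lemma block_flag_dropped i s : nhalts i (iter s (nstep i) (nrun i b)) ->
  ~ forall N, exists2 n, N <= n & bit 0 ((iter n mstep (mrun b)).2 0).
Proof.
rewrite -sim_nrun => /flag_dropped [N HN] /(tracks_limsup block_flag_tracks) /(_ N).
by case=> u /HN ->.
Qed.

Lemma block_flag_up : uncountable_stage b ->
  (forall i s, ~~ nhalts i (iter s (nstep i) (nrun i b))) ->
  forall N, exists2 n, N <= n & bit 0 ((iter n mstep (mrun b)).2 0).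
Proof.
move=> u nh; apply: tracks_limsup_inv block_flag_tracks _ => N.
exists N.+1 => //; apply: flag_stays_up => //; first exact: stage_kind_uncountable.
by move=> i s; rewrite sim_nrun.
Qed.

Lemma tm_step_state (c : state (nstates M) * nat * tape) :
  (mstep c).1.1 = (@trans M c.1.1 (c.2 c.1.2)).1.1.
Proof. by case: c => [[q h] t] /=; case: (trans _ _) => [[]]. Qed.

(** Halting needs the limit state and a raised flag. No transition enters the limit state, and at a
    block start in that state the flag is down. *)
Lemma block_no_halt n : (iter n.+1 mstep (mrun b)).1.1 <> q_halt.
Proof.
elim: n => [|n IH]; rewrite [iter _ _ _]/= tm_step_state => /halt_cases; last first.
  case=> [//|[E _]]; move: E; rewrite tm_step_state; exact: not_limit.
rewrite (run_block_start _ _ B) /=; case=> [|[]].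
  by case: (stage_kind b) => [[]|].
case E: (stage_kind b) => [[]|] // _ H.
by have := stage_kind_flag E; rewrite /bit H.
Qed.
End OneBlock.

(** The hypothesis says that every flag raised before [x] is lowered within its own block. Simulated
    tapes agree at limits by [limsup_blocks], block by block. *)
Lemma simulation_inv x : block_start_at x ->
  (forall b, uncountable_stage b -> olt b x ->
     exists i s, nhalts i (iter s (nstep i) (nrun i b))) ->
  block_inv x /\ flag_inv x.
Proof.
elim/(well_founded_ind (@olt_wf A)): x => x IH B H.
have [rz _ rl] := run_is_run (@kind_state (nstates M)) mstep A.
have {}IH b : block_start_at b -> olt b x -> block_inv b /\ flag_inv b.
  by move=> Bb bx; apply: IH => // b' u b'b; apply: H => //; apply: olt_trans b'b bx.
case: B => [z|l].
  rewrite /block_inv /flag_inv rz //; split=> //; split=> // i m.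
  by rewrite /nrun (arun_zero (run_is_run _ _ _)).
have afterE b n z i : after b n z -> mrun z = iter n mstep (mrun b) /\
    nrun i z = iter n (nstep i) (nrun i b).
  by move=> a; rewrite /nrun !(run_after _ _ a).
split; first split.
- move=> n; rewrite rl // bit_limit_tape; apply/negbTE/negP => /asboolP L.
  have [y yx] : exists y, olt y x.
    by apply: contrapT => ne; apply: l.1 => y yx; apply: ne; exists y.
  have [z [_ zx]] := L y yx; have [b [m [Bb a]]] := after_ex z.
  have [bi fi] := IH b Bb (ole_olt_trans (after_ge a) zx).
  have [-> _] := afterE _ _ _ 0 a.
  by rewrite (block_run_spec Bb bi fi).1.
- move=> i m; rewrite rl // /nrun (arun_limit (run_is_run _ _ _) l).
  have E j : bit j (limit_tape x (fun y => (mrun y).2) (K.+1 * (npair i m).+1)) =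
      bit j (limit_tape x (fun y => (nrun i y).2) m).
    rewrite !bit_limit_tape; apply/idP/idP; apply: limsup_blocks => // b Bb bx;
      have [bi fi] := IH b Bb bx; have T := block_region_tracks Bb bi fi i m j; split.
    + move=> [n [z [a fz]]]; have [Mz _] := afterE _ _ _ i a; rewrite Mz in fz.
      have [s gs] := tracks_sup T (ex_intro _ n fz).
      have [w aw _] := after_total s l bx; have [_ Nw] := afterE _ _ _ i aw.
      by exists s, w; rewrite Nw.
    + move=> c N; have [|s Ns gs] := tracks_limsup T _ N.
        move=> N'; have [n [z [Nn a fz]]] := c N'; exists n => //.
        by have [<- _] := afterE _ _ _ i a.
      have [w aw _] := after_total s l bx; have [_ Nw] := afterE _ _ _ i aw.
      by exists s, w; rewrite Nw.
    + move=> [n [z [a fz]]]; have [_ Nz] := afterE _ _ _ i a; rewrite Nz in fz.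
      have [s gs] := tracks_sup_inv T (ex_intro _ n fz).
      have [w aw _] := after_total s l bx; have [Mw _] := afterE _ _ _ i aw.
      by exists s, w; rewrite Mw.
    + move=> c N; have [|s Ns gs] := tracks_limsup_inv T _ N.
        move=> N'; have [n [z [Nn a fz]]] := c N'; exists n => //.
        by have [_ <-] := afterE _ _ _ i a.
      have [w aw _] := after_total s l bx; have [Mw _] := afterE _ _ _ i aw.
      by exists s, w; rewrite Mw.
  exact: symbols_ext E.
- move=> nu; rewrite rl //= -[LHS]/(bit 0 (limit_tape x (fun y => (mrun y).2) 0)).
  rewrite bit_limit_tape; apply/negbTE/negP => L.
  (* Otherwise uncountable cardinals would be cofinal in [x], and [x] would be one itself. *)
  have [y0 [y0x ny0]] : exists y, olt y x /\
      forall z, ole y z -> olt z x -> ~ uncountable_stage z.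
    apply: contrapT => ne; apply: nu; apply: uncountable_sup => // y yx.
    apply: contrapT => nz; apply: ne; exists y; split=> // z yz zx u.
    by apply: nz; exists z.
  case: (limsup_cases l L y0x) => [[b [n [z [Bb yb bx a fz]]]]|[b [N [Bb bx a c]]]];
    have [bi fi] := IH b Bb bx.
    have [Mz _] := afterE _ _ _ 0 a; rewrite Mz in fz.
    by move: fz; rewrite block_flag_down //; apply: ny0 => //; right.
  have c' N' : exists2 n, N' <= n & bit 0 ((iter n mstep (mrun b)).2 0).
    have [n [z [Nn a' fz]]] := c N'; exists n => //.
    by have [<- _] := afterE _ _ _ 0 a'.
  have [u|nub] := pselect (uncountable_stage b).
    have [i [s hs]] := H b u bx.
    exact: block_flag_dropped Bb bi fi i s hs c'.
  by have [n _] := c' 0; rewrite block_flag_down.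
Qed.
End Simulation.

(** * A cardinal at which no machine halts *)

Lemma nstep_flag i c :
  bit 0 ((nstep i c).2 0) = ((nstep i c).1.1 == 1) || bit 0 (c.2 0).
Proof. by case: c => [[q h] T]. Qed.

(** Successor steps never lower cell 0 of a numbered machine, and at a limit it is the limsup of
    values that are eventually all true. *)
Lemma nhalts_flag i (A : ordinal_number) (y x : A) :
  nhalts i (nrun i y) -> olt y x -> bit 0 ((nrun i x).2 0).
Proof.
move=> /andP [h _]; have [_ rs rl] := run_is_run kind_code (nstep i) A.
elim/(well_founded_ind (@olt_wf A)): x => x IH yx.
case: (stage_cases x) => [z|[w s]|l]; first by case: (z y).
  rewrite /nrun (rs _ _ s) nstep_flag; apply/orP.
  by case: (s.2 _ yx) => [<-|yw]; [left|right; apply: IH => //; apply: s.1].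
rewrite /nrun rl // bit_limit_tape; apply/asboolP => z zx.
have [w [yw mw] wx] := limit_succ l yx.
case: (olt_ole y z) => [yz|zy]; first by exists z; split; [left| |apply: IH].
by exists w; split=> //; [right; apply: ole_olt_trans zy yw|apply: IH].
Qed.

Lemma nhalts_unique i (A : ordinal_number) (y x : A) :
  nhalts i (nrun i y) -> nhalts i (nrun i x) -> y = x.
Proof.
move=> hy hx; case: (olt_total y x) => [lt|[//|lt]].
  by have := nhalts_flag hy lt; case/andP: hx => _ /negbTE ->.
by have := nhalts_flag hx lt; case/andP: hy => _ /negbTE ->.
Qed.

Definition silent (A : ordinal_number) (x : A) : Prop := uncountable_stage x /\
  forall i s, ~~ nhalts i (iter s (nstep i) (nrun i x)).

Lemma silent_initial (A B : ordinal_number) (f : A -> B) x : initial f ->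
  silent (f x) <-> silent x.
Proof.
move=> fI; rewrite /silent (initial_uncountable fI).
suff E i : nrun i (f x) = nrun i x by split=> -[u h]; split=> // i s; move: (h i s); rewrite E.
exact: run_initial.
Qed.

Lemma olt_omega (A : ordinal_number) (m n : nat) :
  olt (inr m : ord_add A ord_omega) (inr n) <-> m < n.
Proof.
split=> [H|mn]; last exact: (le_bb _ _ _ (@olt ord_omega) m n mn).
by inversion H.
Qed.

Lemma succ_omega (A : ordinal_number) (n : nat) :
  is_succ (inr n : ord_add A ord_omega) (inr n.+1).
Proof.
split=> [|[z|z]]; [exact/olt_omega|by right; constructor|move/olt_omega].
by rewrite ltnS leq_eqVlt => /orP [/eqP ->|lt]; [left|right; apply/olt_omega].
Qed.

Lemma after_omega (A : ordinal_number) n :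
  after (inr 0 : ord_add A ord_omega) n (inr n).
Proof.
elim: n => [|n IH]; first exact: after0.
exact: afterS IH (succ_omega A n).
Qed.

(** [W i] contains the stage of the first halt of machine [i], if there is one. A cardinal that
    injects into no [W i] lies beyond all these stages together with its block. *)
Lemma silent_ex : exists (A : ordinal_number) (x : A), silent x.
Proof.
have ex i : exists W : ordinal_number,
    (exists (A : ordinal_number) (x : A), nhalts i (nrun i x)) ->
    exists x : W, nhalts i (nrun i x).
  have [[A Ax]|n] := pselect (exists (A : ordinal_number) (x : A), nhalts i (nrun i x)).
    by exists A.
  by exists ord_one => /n.
have [W WP] := choice ex.
have [kappa [ck nk]] := large_cardinal (nat + {i : nat & W i}).
have nkW i : ~ injects kappa (W i).
  move=> [f fi]; apply: nk; exists (fun z => inr (existT W i (f z))) => y z [] E.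
  exact/fi/(eq_from_Tagged E).
have nkN : ~ injects kappa nat.
  by move=> [f fi]; apply: nk; exists (inl \o f) => y z [/fi].
pose A := ord_add kappa ord_omega; exists A, (inr 0); split.
  apply: (@uncountable_cardinal_transfer kappa).
  - split.
      exists (fun z : kappa => exist (fun w : A => olt w (inr 0)) (inl z) (le_ab _ _ _ _ z 0)).
      by move=> y z /(congr1 sval) [].
    have exi (u : segment (inr 0 : A)) : exists z, inl z = sval u.
      case: u => -[z|n] /= H; first by exists z.
      by inversion H.
    have [g gE] := choice exi; exists g => u v E.
    by apply: segment_inj; rewrite -!gE E.
  - move=> u; have [z zu] : exists z, inl z = sval u.
      case: u => -[z|n] /= H; first by exists z.
      by inversion H.
    exists z; apply: injects_trans (segment_segment u).1 _; rewrite -zu.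
    exact: (initial_segment (initial_inl kappa ord_omega) z).2.
  - by split=> //; rewrite countableTP.
move=> i s; apply/negP; rewrite /nrun -(run_after _ _ (after_omega kappa s)) => hs.
have [x hx] := WP i (ex_intro _ A (ex_intro _ (inr s) hs)).
(* By uniqueness, a first halt at kappa + [s] is the image of the one in [W i], so all of kappa
   would embed into [W i]. *)
apply: (nkW i); case: (comparable_ordinals (W i) A) => [[f fI]|[f fI]].
  have fx : f x = inr s.
    by apply: (@nhalts_unique i) hs; rewrite /nrun run_initial.
  have exz (z : kappa) : exists w, f w = inl z.
    by apply: (fI.2 x); rewrite fx; constructor.
  have [g gE] := choice exz; exists g => y z E.
  by have := gE y; rewrite E gE => -[].
by exists (f \o inl) => y z /(initial_inj fI) [].
Qed.

(** Halting at stage [A] would be a first halt at step 0 of the silent block. *)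
Lemma program_not_halting (A : ordinal_number) p :
  silent (inr tt : ord_add A ord_one) -> ~ halts_at p A.
Proof.
move=> [_ sil] [c [/is_run_abstract cr ch cn]]; have [i iE] := program_table p.
have [e1 e2 e3 e4] := nrun_program iE cr (inr tt).
have := sil i 0; rewrite -[iter 0 _ _]/(run kind_code (nstep i) (inr tt : ord_add A ord_one)) /nhalts.
rewrite e4 ?andbT; last first.
  move=> [y|[]] H; last by inversion H.
  rewrite -to_abstract_step; exact: cn.
have [+ _ _ _] := nstep_program iE (to_abstract (c (inr tt))).1.1
  (to_abstract (c (inr tt))).1.2 e3.
have -> : (state_code (to_abstract (c (inr tt))).1.1, (to_abstract (c (inr tt))).1.2,
    (run kind_code (nstep i) (inr tt : ord_add A ord_one)).2) =
    run kind_code (nstep i) (inr tt : ord_add A ord_one).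
  by rewrite -e1 -e2 -!surjective_pairing.
move=> -> /negP; apply.
by rewrite -[(_, _, _)]/(to_abstract (c (inr tt))) -to_abstract_step /= ch.
Qed.

(** * Clocking kappa + omega for the first silent cardinal kappa *)

Section FirstSilent.
Variable kappa : ordinal_number.
Local Notation D := (ord_add (ord_add kappa ord_omega) ord_one).
Let at_kappa : D := inl (inr 0).
Let top : D := inr tt.

Hypothesis silent_kappa : silent at_kappa.
Hypothesis silent_least : forall y : kappa, ~ silent (inl (inl y) : D).

Lemma omega_initial : initial (inl : ord_add kappa ord_omega -> D).
Proof. exact: initial_inl. Qed.

Lemma after_kappa n : after at_kappa n (inl (inr n)).
Proof.
elim: n => [|n IH]; first exact: after0.
exact: afterS IH (initial_succ omega_initial (succ_omega kappa n)).
Qed.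

Lemma olt_top (x : ord_add kappa ord_omega) : olt (inl x : D) top.
Proof. by constructor. Qed.

Lemma olt_at_kappa (y : D) : olt y at_kappa -> exists z, y = inl (inl z).
Proof.
move=> /(initial_below omega_initial) [[z|n] H <-]; first by exists z.
by move/olt_omega: H.
Qed.

Lemma top_limit : is_limit top.
Proof.
split=> [z|[[y|n]|[]] [lt m]]; first by apply: (z at_kappa); apply: olt_top.
- have lt' : olt (inl (inl y) : D) at_kappa by apply: omega_initial.1; constructor.
  by case: (ole_not_olt (m at_kappa (olt_top _)) lt').
- have lt' : olt (inl (inr n) : D) (inl (inr n.+1)).
    by apply: omega_initial.1; apply/olt_omega.
  by case: (ole_not_olt (m (inl (inr n.+1)) (olt_top _)) lt').
- by case: (olt_irr lt).
Qed.

Lemma top_not_uncountable : ~ uncountable_stage top.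
Proof.
move=> [/is_cardinalP H _].
have ku : ~ injects kappa nat.
  move=> i; have [[_ nc] _] := silent_kappa; apply: nc; rewrite countableTP.
  apply: injects_trans i.
  have exz (u : segment at_kappa) : exists z, sval u = inl (inl z).
    exact: olt_at_kappa (svalP u).
  have [g gE] := choice exz; exists g => u v E.
  by apply: segment_inj; rewrite !gE E.
pose u : segment top := exist (fun z => olt z top) at_kappa (olt_top _).
apply: (H u); apply: (@injects_trans (kappa + nat)).
  have exz (v : segment top) : exists z : kappa + nat, sval v = inl z.
    case: v => -[z|[]] /= lt; first by exists z.
    by case: (@olt_irr D top).
  have [g gE] := choice exz; exists g => v w E.
  by apply: segment_inj; rewrite !gE E.
apply: injects_trans (infinite_add_nat ku) _.
apply: (@injects_trans (segment at_kappa)); last exact: (segment_segment u).2.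
have lt (z : kappa) : olt (inl (inl z) : D) at_kappa.
  by apply: omega_initial.1; constructor.
exists (fun z => exist (fun w => olt w at_kappa) (inl (inl z)) (lt z)) => y z.
by move/(congr1 sval) => [].
Qed.

Lemma block_start_kappa (b : D) : block_start_at b -> olt b top -> ole b at_kappa.
Proof.
case: b => [[z|[|n]]|[]] B lt.
- by right; apply: omega_initial.1; constructor.
- by left.
- have [lt' m] := initial_succ omega_initial (succ_omega kappa n).
  case: B => [z|[_ ns]]; first by case: (z _ lt').
  by case: (ns (inl (inr n))).
- by case: (olt_irr lt).
Qed.

Lemma halts_before (b x : D) : ole x at_kappa -> uncountable_stage b -> olt b x ->
  exists i s, nhalts i (iter s (nstep i) (nrun i b)).
Proof.
move=> xk u bx; have [z bz] := olt_at_kappa (olt_ole_trans bx xk); subst b.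
apply: contrapT => ne; apply: (silent_least (y := z)); split=> // i s.
by apply/negP => h; apply: ne; exists i, s.
Qed.

(** Every block start below [top] is at most [at_kappa], so minimality of kappa provides the
    hypothesis of [simulation_inv] and no earlier transition halts. The flag raised at kappa is
    never lowered in its block, so its limsup at [top] is up. *)
Lemma first_silent_clockable : clockable (ord_add kappa ord_omega).
Proof.
have [M [K [Mhalt Mnl Mlim Mblock]]] :=
  numeric_control comp1_pos comp2_next comp2_write ctl_start.
pose mrun (x : D) := run (@kind_state (nstates M)) (tm_step (@trans M)) x.
have inv b : block_start_at b -> olt b top -> block_inv M K b /\ flag_inv M b.
  move=> B lt; apply: (simulation_inv Mblock) => // b' u b'b.
  exact: halts_before (block_start_kappa B lt) u b'b.
have stepE x : cstate (step (of_abstract (mrun x))) = (tm_step (@trans M) (mrun x)).1.1.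
  by rewrite -of_abstract_step.
exists M, (@of_abstract M \o mrun); split.
- exact/abstract_is_run/run_is_run.
- have Bk : block_start_at at_kappa by right; apply: uncountable_limit; case: silent_kappa.
  have [bi fi] := inv _ Bk (olt_top _).
  rewrite /= stepE tm_step_state /mrun (arun_limit (run_is_run _ _ _) top_limit).
  rewrite (asboolF top_not_uncountable) /=; apply: Mlim.
  rewrite bit_limit_tape; apply/asboolP => y lt.
  have [N yN] : exists N, ole y (inl (inr N)).
    case: y lt => [[z|N]|[]] lt; last by case: (olt_irr lt).
      by exists 0; right; apply: omega_initial.1; constructor.
    by exists N; left.
  have [n Nn fn] := block_flag_up Mblock Bk bi fi silent_kappa.1 silent_kappa.2 N.
  exists (inl (inr n)); split; last by rewrite (run_after _ _ (after_kappa n)).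
    exact: ole_trans yN (after_mono (after_kappa N) (after_kappa n) Nn).
  exact: olt_top.
- move=> x; rewrite /= stepE; have [b [n [B a]]] := after_ex (inl x : D).
  have [bi fi] := inv b B (ole_olt_trans (after_ge a) (olt_top x)).
  rewrite /mrun (run_after _ _ a) -iterS.
  exact: (block_no_halt Mhalt Mnl B fi).
Qed.
End FirstSilent.

Theorem theorem3 :
  exists kappa : ordinal_number,
    [/\ is_cardinal kappa,
        ~ clockable kappa &
        clockable (ord_add kappa ord_omega)].
Proof.
have [A exA] := silent_ex; have [x [sx mx]] := ex_least exA.
pose kappa := segment x.
(* Silence is a property of stages, and kappa + 1 is the least ordinal with kappa as a stage; it
   embeds both into [A] and into (kappa + omega) + 1. *)
pose f (u : ord_add kappa ord_one) : A := match u with inl z => sval z | inr _ => x end.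
have fI : initial f.
  split=> [[y|[]] [z|[]] H|[y|[]] z H] /=.
  - by inversion H.
  - exact: (svalP y).
  - by inversion H.
  - by inversion H.
  - have zx : olt z x by apply: olt_trans H (svalP y).
    by exists (inl (exist _ z zx)).
  - by exists (inl (exist _ z H)).
pose D := ord_add (ord_add kappa ord_omega) ord_one.
pose g (u : ord_add kappa ord_one) : D :=
  match u with inl z => inl (inl z) | inr _ => inl (inr 0) end.
have gI : initial g.
  split=> [[y|[]] [z|[]] H|[y|[]] z H] /=.
  - by inversion H; do 2!constructor.
  - by do 2!constructor.
  - by inversion H.
  - by inversion H.
  - have [[w|w] Hw <-] := initial_below (initial_inl _ _) H; first by exists (inl w).
    by inversion Hw.
  - by have [w ->] := olt_at_kappa H; exists (inl w).
have sk : silent (inr tt : ord_add kappa ord_one).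
  by apply/(silent_initial _ fI).
exists kappa; split.
- by case: sx => -[].
- by move=> [p]; apply: program_not_halting.
- apply: first_silent_clockable.
    exact: (silent_initial (inr tt : ord_add kappa ord_one) gI).2 sk.
  move=> y sy; apply: (mx (sval y) (svalP y)).
  apply: (silent_initial (inl y : ord_add kappa ord_one) fI).2.
  exact: (silent_initial (inl y : ord_add kappa ord_one) gI).1 sy.
Qed.
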